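(* Let $d\ge 1$, let $A=(A(k,l))_{k,l\in\mathbb{Z}^d}$ be a complex matrix over $\mathbb{Z}^d$, let $r>d$, and let $\alpha=(\alpha_1,\dots,\alpha_d)\in\mathbb{Z}^d$ with $\alpha_j\ge 0$ for all $j$. Suppose that $A$ is invertible on $\ell^2(\mathbb{Z}^d)$ and that there is a constant $C>0$ such that $$|A(k,l)|\le C(1+|k-l|)^{-r}\prod_{j=1}^d(1+|k_j-l_j|)^{-\alpha_j}\qquad\text{for all }k,l\in\mathbb{Z}^d.$$ Then there is a constant $C'>0$ such that the entries of the inverse matrix $A^{-1}$ satisfy $$|(A^{-1})(k,l)|\le C'(1+|k-l|)^{-r}\prod_{j=1}^d(1+|k_j-l_j|)^{-\alpha_j}\qquad\text{for all }k,l\in\mathbb{Z}^d.$$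
   Context: For $x\in\mathbb{R}^d$, $|x|=\sum_j|x_j|$ denotes the $1$-norm. A matrix is identified with the operator it induces on $\ell^2(\mathbb{Z}^d)$; ''invertible on $\ell^2(\mathbb{Z}^d)$'' means that this operator is bounded and has a bounded inverse on $\ell^2(\mathbb{Z}^d)$, and $A^{-1}(k,l)$ are the matrix entries of that inverse with respect to the standard basis. *)

(* Defs.v *)
From HB Require Import structures.
From mathcomp Require Import all_boot all_order all_algebra.
From mathcomp Require Import finmap complex lra summability.
From mathcomp Require Import all_classical all_reals all_analysis.

Set Implicit Arguments.
Unset Strict Implicit.
Unset Printing Implicit Defensive.

Import Order.TTheory GRing.Theory Num.Theory.
Import numFieldNormedType.Exports.
Import ComplexField.Normc.

Local Open Scope classical_set_scope.
Local Open Scope ring_scope.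

Section SquareSummable.
Context (R : realType) (I : choiceType).
Implicit Types x y : I -> R[i]^o.

Definition sqsum x : \bar R := \esum_(k in [set: I]) (normc (x k) ^+ 2)%:E.

Definition square_summable : {pred I -> R[i]^o} :=
  [pred x | `[< (sqsum x < +oo)%E >]].

Let normc_ge0 (z : R[i]) : 0 <= normc z.
Proof. by case: z => a b; exact: sqrtr_ge0. Qed.

Lemma sqsum_ge0 x : (0 <= sqsum x)%E.
Proof. by apply: esum_ge0 => k _; rewrite lee_fin sqr_ge0. Qed.

Lemma le_sqsum_lin (a : R[i]) x y :
  (sqsum (a *: x + y)%R <=
   (2 * normc a ^+ 2)%:E * sqsum x + 2%:E * sqsum y)%E.
Proof.
have esumZ (c : R) (f : I -> \bar R) : (0 <= c) -> (forall k, 0 <= f k)%E ->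
    (\esum_(k in [set: I]) (c%:E * f k) <= c%:E * \esum_(k in [set: I]) f k)%E.
  move=> c0 f0; apply: ub_ereal_sup => _ [F [finF _] <-] /=.
  rewrite -ge0_mule_fsumr//; apply: lee_wpmul2l; first by rewrite lee_fin.
  by apply: ereal_sup_ubound; exists F.
apply: (@le_trans _ _ (\esum_(k in [set: I])
   ((2 * normc a ^+ 2)%:E * (normc (x k) ^+ 2)%:E
     + 2%:E * (normc (y k) ^+ 2)%:E)%E)).
  apply: le_esum => k _; rewrite -!EFinM -EFinD lee_fin.
  apply: (@le_trans _ _ ((normc (a * x k) + normc (y k)) ^+ 2)).
    rewrite lerXn2r ?nnegrE ?addr_ge0 ?normc_ge0//.
    exact: (le_normcD (a * x k) (y k)).
  rewrite normcM.
  move: (normc a) (normc (x k)) (normc (y k)) => u v w.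
  rewrite -mulrA -exprMn sqrrD.
  have := sqr_ge0 (u * v - w); rewrite sqrrB; lra.
rewrite esumD; last 2 first.
- by move=> k _; rewrite -EFinM lee_fin !mulr_ge0 ?sqr_ge0 ?exprn_ge0.
- by move=> k _; rewrite -EFinM lee_fin mulr_ge0 ?sqr_ge0.
by apply: leeD; apply: esumZ => [|k]; rewrite ?lee_fin ?mulr_ge0 ?sqr_ge0.
Qed.

Lemma square_summable_submod_closed : submod_closed square_summable.
Proof.
split=> [|a x y].
  rewrite inE /sqsum esum1 ?ltry// => k _.
  by rewrite -[(0 : I -> R[i]^o) k]/(0 : R[i]) normc0 expr0n.
rewrite !inE => xfin yfin.
apply: (le_lt_trans (le_sqsum_lin a x y)).
apply: lte_add_pinfty; apply: lte_mul_pinfty;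
  by rewrite ?lee_fin ?mulr_ge0 ?sqr_ge0.
Qed.

HB.instance Definition _ :=
  GRing.isSubmodClosed.Build R[i] (I -> R[i]^o) square_summable
    square_summable_submod_closed.

Definition delta (l : I) : I -> R[i]^o := fun k => (k == l)%:R.

Lemma delta_square_summable l : delta l \in square_summable.
Proof.
rewrite inE /sqsum (eq_esum (b := fun k => if k \in [set l]
  then (1 : R)%:E else 0%E)); last first.
  move=> k _; rewrite /delta; case: (eqVneq k l) => [->|/eqP kl].
    by rewrite mem_set// normc1 expr1n.
  by rewrite memNset// normc0 expr0n.
by rewrite -esum_mkcond esum_set1 ?ltry// lee_fin.
Qed.

End SquareSummable.

Record ell2 (R : realType) (I : choiceType) := Ell2 {
  ell2_fun :> I -> R[i]^o ;
  ell2P : ell2_fun \in @square_summable R I }.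

HB.instance Definition _ R I := [isSub of @ell2 R I for @ell2_fun R I].
HB.instance Definition _ R I := [Choice of @ell2 R I by <:].
HB.instance Definition _ R I := [SubChoice_isSubLmodule of @ell2 R I by <:].

Section Operators.
Context (R : realType) (I : choiceType).

Definition ell2norm (x : ell2 R I) : R := Num.sqrt (fine (sqsum x)).

Definition unit_vec (l : I) : ell2 R I := Ell2 (delta_square_summable R l).

Definition bounded_op (T : {linear ell2 R I -> ell2 R I}) : Prop :=
  exists M : R, forall x, ell2norm (T x) <= M * ell2norm x.

(* The sum over l converges unconditionally, along the net of finite subsets
   of I. *)
Definition induces (A : I -> I -> R[i]) (T : {linear ell2 R I -> ell2 R I}) :
    Prop :=
  forall (x : ell2 R I) (k : I),
    partial_sum (fun l => A k l * x l : R[i]^o) @ totally --> (T x k : R[i]^o).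

Definition is_inverse_on_ell2 (A : I -> I -> R[i])
    (S : {linear ell2 R I -> ell2 R I}) : Prop :=
  bounded_op S /\
  exists T : {linear ell2 R I -> ell2 R I},
    [/\ induces A T, bounded_op T, cancel T S & cancel S T].

Definition entry (S : {linear ell2 R I -> ell2 R I}) (k l : I) : R[i] :=
  S (unit_vec l) k.

End Operators.

(* The library norm `|x| on row vectors is the sup norm. *)
Definition norm1 (d : nat) (x : 'rV[int]_d) : int := \sum_(j < d) `|x 0 j|.

Definition decay (R : realType) (d : nat) (r : R) (alpha x : 'rV[int]_d) : R :=
  (1 + (norm1 x)%:~R) `^ (- r) *
  \prod_(j < d) (1 + `|x 0 j|%:~R) ^ (- alpha 0 j).

(* Main.v *)
Require Import Defs.
From mathcomp Require Import all_boot all_order all_algebra complex.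
From mathcomp Require Import finmap lra ring zify summability.
From mathcomp Require Import all_classical all_reals all_analysis.

Set Implicit Arguments.
Unset Strict Implicit.
Unset Printing Implicit Defensive.

Import Order.TTheory GRing.Theory Num.Theory.
Import numFieldNormedType.Exports.
Import ComplexField.Normc.

Local Open Scope classical_set_scope.
Local Open Scope ring_scope.

(* Write B for the inverse, u(x) = (1+|x|)^-r, and first let alpha = 0.  Fix a
   column f = B e_l and cut Z^d into cubes of side N+1.  Multiply f by a window
   w(k) = (L + |n - q(k)|)^-r, where q(k) is the cube containing k, and apply
   |w f|_2 <= M |A (w f)|_2; since A f = e_l, what remains is the commutator of
   A with w.  Between nearby cubes w varies by a factor close to 1, so that part
   is absorbed by the left-hand side once L is large.  Between distant cubes
   the l^1 norm bounds the l^2 norm, and with s(n) the l^1 norm of f on the cube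
   n one gets  s(n) <= D u(n - q(l)) + eps (u * s)(n),  with eps of order
   N^(d-r).  Because u * u <= const u, iterating gives s(n) <= 2 D u(n - q(l)).
   The weight prod_j (1+|k_j - l_j|)^-alpha_j is then gained one factor at a
   time from D_j B = - B (D_j A) B, where D_j multiplies the (k, l) entry by
   k_j - l_j: matrices dominated by such a weight form an algebra, as the
   product part of the weight is submultiplicative. *)

(** * Sums of nonnegative families *)

Section NonnegativeSums.
Context {R : realType}.

Definition esumR {I : choiceType} (f : I -> R) : \bar R :=
  \esum_(i in [set: I]) (f i)%:E.

Definition sum_le {I : choiceType} (f : I -> R) (c : R) : Prop :=
  (esumR f <= c%:E)%E.

(** [fine] sends an infinite sum to 0, so this is the value of the sum only when some [sum_le] bound
    holds. *)
Definition rsum {I : choiceType} (f : I -> R) : R := fine (esumR f).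

Context {I : choiceType}.
Implicit Types (f g : I -> R) (c : R).

Lemma esumR_ge0 f : (forall i, 0 <= f i) -> (0 <= esumR f)%E.
Proof. by move=> f0; apply: esum_ge0 => i _; rewrite lee_fin. Qed.

Lemma sum_leP f c :
  sum_le f c <-> forall F : {fset I}, \sum_(i <- F) f i <= c.
Proof.
split=> [fc F|fc].
  rewrite -lee_fin; apply: le_trans fc; apply: ereal_sup_ubound.
  exists [set` F]; first by split => //; exact: finite_fset.
  by rewrite fsbig_finite//= set_fsetK sumEFin.
apply: ge_ereal_sup => _ [A [finA _] <-].
by rewrite fsbig_finite//= sumEFin lee_fin.
Qed.

Lemma rsum_ge0 f : (forall i, 0 <= f i) -> 0 <= rsum f.
Proof. by move=> f0; apply: fine_ge0; exact: esumR_ge0. Qed.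

Lemma rsumK f c : (forall i, 0 <= f i) -> sum_le f c ->
  esumR f = (rsum f)%:E.
Proof.
move=> f0 fc; rewrite fineK// fin_numElt.
rewrite (lt_le_trans _ (esumR_ge0 f0)) ?ltNyr//=.
by rewrite (le_lt_trans fc) ?ltry.
Qed.

Lemma rsum_le f c : (forall i, 0 <= f i) -> sum_le f c -> rsum f <= c.
Proof. by move=> f0 fc; rewrite -lee_fin -(rsumK f0 fc). Qed.

Lemma sum_le_rsum f c : (forall i, 0 <= f i) -> sum_le f c ->
  sum_le f (rsum f).
Proof. by move=> f0 fc; rewrite /sum_le -(rsumK f0 fc). Qed.

Lemma sum_le_mono f g c c' : (forall i, f i <= g i) -> c <= c' ->
  sum_le g c -> sum_le f c'.
Proof.
move=> fg cc /sum_leP gc; apply/sum_leP => F.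
by apply: le_trans cc; apply: le_trans (gc F); apply: ler_sum.
Qed.

Lemma sum_le_term f c i : sum_le f c -> f i <= c.
Proof. by move=> /sum_leP/(_ [fset i]%fset); rewrite big_seq_fset1. Qed.

Lemma sum_le_ge0 f c : (forall i, 0 <= f i) -> sum_le f c -> 0 <= c.
Proof. by move=> f0 /sum_leP/(_ fset0); rewrite big_seq_fset0. Qed.

Lemma sum_leD f g c c' : sum_le f c -> sum_le g c' ->
  sum_le (fun i => f i + g i) (c + c').
Proof.
move=> /sum_leP fc /sum_leP gc; apply/sum_leP => F.
by rewrite big_split lerD.
Qed.

Lemma sum_leZ f c a : 0 <= a -> sum_le f c ->
  sum_le (fun i => a * f i) (a * c).
Proof.
move=> a0 /sum_leP fc; apply/sum_leP => F.
by rewrite -mulr_sumr ler_wpM2l.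
Qed.

Lemma sum_le_sqr f c : (forall i, 0 <= f i) -> sum_le f c ->
  sum_le (fun i => f i ^+ 2) (c ^+ 2).
Proof.
move=> f0 fc; apply: (@sum_le_mono _ (fun i => c * f i) (c * c)) => //.
  by move=> i; rewrite expr2 ler_wpM2r// (sum_le_term _ fc).
by apply: sum_leZ => //; exact: sum_le_ge0 fc.
Qed.

Lemma sum_le_one f (i0 : I) : (forall i, i != i0 -> f i = 0) -> 0 <= f i0 ->
  sum_le f (f i0).
Proof.
move=> fi0 f0; apply/sum_leP => F.
have [i0F|i0F] := boolP (i0 \in F).
  by rewrite (big_fsetD1 i0)//= big_seq big1 ?addr0// => i;
    rewrite !inE => /andP[/fi0].
rewrite big_seq big1// => i iF; apply: fi0.
by apply: contraNneq i0F => <-.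
Qed.

Lemma rsumD f g c c' : (forall i, 0 <= f i) -> (forall i, 0 <= g i) ->
  sum_le f c -> sum_le g c' -> rsum (fun i => f i + g i) = rsum f + rsum g.
Proof.
move=> f0 g0 fc gc; apply: EFin_inj.
have fg0 i : 0 <= f i + g i by rewrite addr_ge0.
rewrite -(rsumK fg0 (sum_leD fc gc)) EFinD -(rsumK f0 fc) -(rsumK g0 gc).
by rewrite /esumR -esumD// => i _; rewrite lee_fin.
Qed.

(** For every t > 0, K b <= (t K + K b^2 / t) / 2 termwise. Summing, t = 1 already gives finiteness,
    and a good choice of t gives the inequality. *)
Lemma rsum_cauchy_schwarz (K b : I -> R) c X :
  (forall i, 0 <= K i) -> (forall i, 0 <= b i) -> 0 <= c ->
  sum_le K c -> sum_le (fun i => K i * b i ^+ 2) X ->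
  sum_le (fun i => K i * b i) (rsum (fun i => K i * b i)) /\
  rsum (fun i => K i * b i) ^+ 2 <= c * X.
Proof.
move=> K0 b0 c0 Kc KX.
have Kb0 i : 0 <= K i * b i by rewrite mulr_ge0.
have amgm t : 0 < t ->
    sum_le (fun i => K i * b i) ((t * c + t^-1 * X) / 2).
  move=> t0; apply: (@sum_le_mono _
     (fun i => 2^-1 * (t * K i + t^-1 * (K i * b i ^+ 2)))); last first.
  - apply: sum_leZ; first lra.
    by apply: (sum_leD (sum_leZ _ Kc) (sum_leZ _ KX)); rewrite ?invr_ge0 ltW.
  - by rewrite mulrC.
  - move=> i; rewrite -subr_ge0.
    have -> : 2^-1 * (t * K i + t^-1 * (K i * b i ^+ 2)) - K i * b i =
       2^-1 * t^-1 * K i * (t - b i) ^+ 2 by field; rewrite gt_eqF.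
    apply: mulr_ge0; last exact: sqr_ge0.
    by apply: mulr_ge0 => //; rewrite mulr_ge0 ?invr_ge0 ?(ltW t0).
have Kb1 := amgm 1 ltr01.
split; first exact: sum_le_rsum Kb1.
set h := rsum _.
have X0 : 0 <= X by apply: sum_le_ge0 KX => i; rewrite mulr_ge0 ?sqr_ge0.
have [c_gt0|c_le0] := ltP 0 c; last first.
  have cE : c = 0 by apply/eqP; rewrite eq_le c_le0.
  have KE i : K i = 0.
    by apply/eqP; rewrite eq_le K0 andbT -cE; exact: (sum_le_term _ Kc).
  suff -> : h = 0 by rewrite expr0n mulr_ge0.
  apply/eqP; rewrite eq_le rsum_ge0// andbT.
  by apply: rsum_le => //; apply/sum_leP => F; rewrite big1// => i _;
    rewrite KE mul0r.
have h0 : 0 <= h by exact: rsum_ge0.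
have [h_gt0|h_le0] := ltP 0 h; last first.
  have -> : h = 0 by apply/eqP; rewrite eq_le h_le0.
  by rewrite expr0n/= mulr_ge0.
(* With t = h / c the bound reads h <= (h + c X / h) / 2, that is h^2 <= c X; no square root is
   needed. *)
have /rsum_le := amgm (h / c) (divr_gt0 h_gt0 c_gt0).
move=> /(_ Kb0); rewrite -/h invf_div ler_pdivlMr// divfK ?gt_eqF//.
rewrite mulr2n mulrDr mulr1 lerD2l -ler_pdivrMl ?divr_gt0// invf_div.
by rewrite mulrAC -expr2 ler_pdivrMr// mulrC.
Qed.

End NonnegativeSums.

(** * Interchange of sums and the Schur test *)

Section TwoSums.
Context {R : realType} {I J : choiceType}.

Lemma rsum_sum (s : seq I) (f : I -> J -> R) c :
  (forall i j, 0 <= f i j) -> (forall i, sum_le (f i) (c i)) ->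
  rsum (fun j => \sum_(i <- s) f i j) = \sum_(i <- s) rsum (f i).
Proof.
move=> f0 fc; elim: s => [|i s IHs].
  rewrite /rsum /esumR big_nil esum1//= => j _.
  by rewrite big_nil.
rewrite big_cons -IHs -(rsumD (c := c i) (c' := \sum_(i <- s) c i))//.
- by congr rsum; apply/funext => j; rewrite big_cons.
- by move=> j; rewrite sumr_ge0.
- apply/sum_leP => F; rewrite exchange_big; apply: ler_sum => k _.
  by have /sum_leP := fc k.
Qed.

(** Tonelli with explicit bounds: a finite sum over i passes inside the sum over j, where the column
    bounds [g] take over. A single term of a column is also below [g], which makes every row
    summable. *)
Lemma sum_le_exchange (f : I -> J -> R) (g : J -> R) c :
  (forall i j, 0 <= f i j) -> (forall j, sum_le (f ^~ j) (g j)) ->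
  sum_le g c ->
  (forall i, sum_le (f i) (rsum (f i))) /\
  sum_le (fun i => rsum (f i)) c.
Proof.
move=> f0 fg gc.
have fc i : sum_le (f i) c.
  by apply: sum_le_mono gc => // j; exact: (sum_le_term _ (fg j)).
have fr i : sum_le (f i) (rsum (f i)) by exact: sum_le_rsum (fc i).
split=> //; apply/sum_leP => F.
rewrite -(rsum_sum F f0 fc)//; apply: rsum_le.
  by move=> j; rewrite sumr_ge0.
by apply: sum_le_mono gc => // j; have /sum_leP := fg j.
Qed.

Lemma sum_le_reindex (e : I -> J) (f : J -> R) c : bijective e ->
  sum_le f c <-> sum_le (f \o e) c.
Proof.
move=> [e' eK e'K]; rewrite /sum_le /esumR (reindex_esum [set: I] [set: J] e)//.
split=> //; first by move=> x y _ _ /(can_inj eK).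
by move=> y _ /=; exists (e' y).
Qed.

End TwoSums.

(** Cauchy-Schwarz on row i with weights K i j bounds the squared row sum by c1 times the sum of K i
    j * b j ^ 2; interchanging the sums then costs c2. *)
Lemma schur_test {R : realType} {I J : choiceType} (K : I -> J -> R)
    (b : J -> R) c1 c2 X :
  (forall i j, 0 <= K i j) -> (forall j, 0 <= b j) -> 0 <= c1 -> 0 <= c2 ->
  (forall i, sum_le (K i) c1) -> (forall j, sum_le (K ^~ j) c2) ->
  sum_le (fun j => b j ^+ 2) X ->
  (forall i, sum_le (fun j => K i j * b j) (rsum (fun j => K i j * b j))) /\
  sum_le (fun i => rsum (fun j => K i j * b j) ^+ 2) (c1 * c2 * X).
Proof.
move=> K0 b0 c10 c20 Kc1 Kc2 bX.
have [K2r K2] : (forall i, sum_le (fun j => K i j * b j ^+ 2)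
      (rsum (fun j => K i j * b j ^+ 2))) /\
    sum_le (fun i => rsum (fun j => K i j * b j ^+ 2)) (c2 * X).
  apply: (@sum_le_exchange _ _ _ _ (fun j => c2 * b j ^+ 2)).
  - by move=> i j; rewrite mulr_ge0 ?sqr_ge0.
  - move=> j; apply: (@sum_le_mono _ _ _ (fun i => b j ^+ 2 * K i j)).
    + by move=> i; rewrite mulrC.
    + by rewrite mulrC.
    + by apply: sum_leZ => //; rewrite sqr_ge0.
  - exact: sum_leZ.
have CS i := rsum_cauchy_schwarz (K0 i) b0 c10 (Kc1 i) (K2r i).
split=> [i|]; first exact: (CS i).1.
rewrite -mulrA.
by apply: sum_le_mono (sum_leZ c10 K2) => // i; exact: (CS i).2.
Qed.

(** * Operators on l^2 *)

Lemma normc_ge0 {R : rcfType} (z : R[i]) : 0 <= normc z.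
Proof. by case: z => a b; exact: sqrtr_ge0. Qed.

Lemma normc_real {R : rcfType} (t : R) : normc t%:C%C = `|t|.
Proof. by rewrite /normc /= expr0n/= addr0 sqrtr_sqr. Qed.

Lemma normr_normc {R : rcfType} (z : R[i]) : `|z| = (normc z)%:C%C.
Proof. by rewrite normc_def; case: z. Qed.

Lemma normc_sum_le {R : rcfType} {I : eqType} (s : seq I) (z : I -> R[i]) :
  normc (\sum_(i <- s) z i) <= \sum_(i <- s) normc (z i).
Proof.
elim: s => [|i s IHs]; first by rewrite !big_nil normc0.
by rewrite !big_cons (le_trans (le_normcD _ _))// lerD2l.
Qed.

Section Ell2.
Context {R : realType} {I : choiceType}.
Implicit Types (x y : ell2 R I).

Lemma ell2norm_ge0 x : 0 <= ell2norm x.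
Proof. exact: sqrtr_ge0. Qed.

Lemma sum_le_ell2norm x : sum_le (fun k => normc (x k) ^+ 2) (ell2norm x ^+ 2).
Proof.
have := ell2P x; rewrite inE => xfin.
rewrite /sum_le /ell2norm sqr_sqrtr; last by apply: fine_ge0; exact: sqsum_ge0.
rewrite fineK// fin_numElt xfin andbT.
by apply: lt_le_trans (sqsum_ge0 x); rewrite ltNyr.
Qed.

Lemma ell2norm_le x c : 0 <= c -> sum_le (fun k => normc (x k) ^+ 2) (c ^+ 2) ->
  ell2norm x <= c.
Proof.
move=> c0 xc; rewrite -(ler_pXn2r (n := 2))// ?nnegrE ?ell2norm_ge0//.
rewrite sqr_sqrtr; last by apply: fine_ge0; exact: sqsum_ge0.
by apply: rsum_le xc => k; rewrite sqr_ge0.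
Qed.

Lemma normc_le_ell2norm x k : normc (x k) <= ell2norm x.
Proof.
rewrite -(ler_pXn2r (n := 2))// ?nnegrE ?ell2norm_ge0 ?normc_ge0//.
exact: sum_le_term (sum_le_ell2norm x).
Qed.

Lemma ell2_of_sum_le (f : I -> R[i]) c :
  sum_le (fun k => normc (f k) ^+ 2) c -> exists x : ell2 R I, x =1 f.
Proof.
move=> fc; have fP : (f : I -> R[i]^o) \in @square_summable R I.
  by rewrite inE; apply: le_lt_trans fc _; rewrite ltry.
by exists (Ell2 fP).
Qed.

Lemma ell2D x y k : (x + y) k = x k + y k. Proof. by []. Qed.
Lemma ell2B x y k : (x - y) k = x k - y k. Proof. by []. Qed.
Lemma ell2Z (a : R[i]) x k : (a *: x) k = a * x k. Proof. by []. Qed.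
Lemma ell2_sum (s : seq I) (g : I -> ell2 R I) k :
  (\sum_(i <- s) g i) k = \sum_(i <- s) g i k.
Proof.
elim: s => [|i s IHs]; first by rewrite !big_nil.
by rewrite !big_cons ell2D IHs.
Qed.

Lemma unit_vecZ (a : R[i]) (l k : I) :
  (a *: unit_vec R l : ell2 R I) k = a * (k == l)%:R.
Proof. by []. Qed.

Lemma ell2norm_unit_vec (l : I) : ell2norm (unit_vec R l) = 1.
Proof.
apply/eqP; rewrite eq_le; apply/andP; split.
  apply: ell2norm_le => //=.
  apply: (@sum_le_mono _ _ _ (fun k => normc (delta R l k) ^+ 2)
     (normc (delta R l l) ^+ 2)) => //.
    by rewrite /delta eqxx normc1.
  apply: sum_le_one => [k kl|]; last exact: sqr_ge0.
  by rewrite /delta (negbTE kl) normc0 expr0n.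
have := normc_le_ell2norm (unit_vec R l) l.
by rewrite /= /delta eqxx normc1.
Qed.

(** On finitely supported vectors linearity expresses S through its entries. A general y is cut off
    to a finite set, and boundedness of S controls the image of the tail. *)
Lemma normc_op_le (S : {linear ell2 R I -> ell2 R I}) M y k c :
  (forall x, ell2norm (S x) <= M * ell2norm x) ->
  sum_le (fun n => normc (entry S k n) * normc (y n)) c ->
  normc (S y k) <= c.
Proof.
move=> SM Sc.
have M0 : 0 <= M.
  by have := SM (unit_vec R k); rewrite ell2norm_unit_vec mulr1;
    apply: le_trans; exact: ell2norm_ge0.
apply/ler_addgt0Pr => e e0.
(* The tail of y will have norm at most d, so its image costs at most e; dividing by M + 1 covers
   the case M = 0. *)
have [d d0 Mde] : exists2 d, 0 < d & M * d <= e.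
  exists (e / (M + 1)); first by rewrite divr_gt0// ltr_wpDl.
  by rewrite mulrCA ger_pMr// ler_pdivrMr ?mul1r ?lerDl// ltr_wpDl.
set f := fun n => normc (y n) ^+ 2.
have f0 n : 0 <= f n by exact: sqr_ge0.
have fy := sum_le_ell2norm y.
have [F FP] : exists F : {fset I}, rsum f - d ^+ 2 < \sum_(n <- F) f n.
  apply/not_existsP => H.
  suff : rsum f <= rsum f - d ^+ 2.
    by have := exprn_gt0 2 d0; lra.
  apply: rsum_le => //; apply/sum_leP => F.
  by have /negP := H F; rewrite -leNgt.
pose yF := \sum_(n <- F) (y n : R[i]) *: unit_vec R n.
have yFE m : yF m = if m \in F then y m else 0.
  rewrite ell2_sum; case: ifPn => mF.
    rewrite (big_fsetD1 m)// big_seq big1 => [|n].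
      by rewrite unit_vecZ eqxx mulr1; exact: addr0.
    by rewrite !inE unit_vecZ eq_sym => /andP[/negbTE-> _]; rewrite /= mulr0.
  rewrite big_seq big1// => n nF; rewrite unit_vecZ.
  by have [mn|] := eqVneq m n; [rewrite mn nF in mF|rewrite /= mulr0].
have ydF : ell2norm (y - yF) <= d.
  pose f1 n := if n \in F then f n else 0.
  pose f2 n := if n \in F then 0 else f n.
  have f10 n : 0 <= f1 n by rewrite /f1; case: ifP.
  have f20 n : 0 <= f2 n by rewrite /f2; case: ifP.
  have f1y : sum_le f1 (ell2norm y ^+ 2).
    by apply: sum_le_mono fy => // n; rewrite /f1; case: ifP => // _; exact: f0.
  have f2y : sum_le f2 (ell2norm y ^+ 2).
    by apply: sum_le_mono fy => // n; rewrite /f2; case: ifP => // _; exact: f0.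
  have fE : rsum f = rsum f1 + rsum f2.
    rewrite -(rsumD f10 f20 f1y f2y); congr rsum; apply/funext => n.
    by rewrite /f1 /f2; case: ifP; rewrite (addr0, add0r).
  have Ff1 : \sum_(n <- F) f n <= rsum f1.
    have /sum_leP/(_ F) := sum_le_rsum f10 f1y.
    by rewrite (eq_big_seq f) // => n nF; rewrite /f1 nF.
  apply: ell2norm_le; first exact: ltW.
  apply: (@sum_le_mono _ _ _ f2 (rsum f2)); last exact: sum_le_rsum f2y.
    move=> n; rewrite ell2B yFE /f2; case: ifP => _; last by rewrite subr0.
    by rewrite subrr normc0 expr0n.
  by move: FP; rewrite fE ltrBlDr -ltrBlDl => /ltW; lra.
have SyF : normc (S yF k) <= c.
  rewrite linear_sum ell2_sum; apply: le_trans (normc_sum_le _ _) _.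
  have /sum_leP/(_ F) := Sc; apply: le_trans; apply: ler_sum => n _.
  by rewrite linearZ ell2Z normcM mulrC.
rewrite -(subrK yF y) linearD ell2D (le_trans (le_normcD _ _))// addrC lerD//.
apply: le_trans (normc_le_ell2norm _ _) _; apply: le_trans (SM _) _.
by apply: le_trans Mde; rewrite ler_wpM2l.
Qed.

(** With x = tau f, the k-th entry of T x - tau T f is the sum over m of A k m * (tau m - tau k) * f
    m. Since [induces] only gives limits along finite sets, this identity is used on one finite J
    where the series of T x and T f are both near their limits. *)
Lemma commutator_bound (A : I -> I -> R[i])
    (T : {linear ell2 R I -> ell2 R I}) (f : ell2 R I) (tau : I -> R) (t : R) :
  induces A T -> (forall k, `|tau k| <= t) ->
  exists x : ell2 R I, (forall k, x k = (tau k)%:C%C * f k) /\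
    forall k c,
      sum_le (fun m => normc (A k m) * `|tau m - tau k| * normc (f m)) c ->
      normc (T x k) <= `|tau k| * normc (T f k) + c.
Proof.
move=> AT taut.
have [x xE] : exists x : ell2 R I, x =1 (fun k => (tau k)%:C%C * f k).
  apply: (@ell2_of_sum_le _ (t ^+ 2 * ell2norm f ^+ 2)).
  apply: sum_le_mono (sum_leZ _ (sum_le_ell2norm f)); rewrite ?sqr_ge0// => k.
  rewrite normcM normc_real exprMn ler_wpM2r ?sqr_ge0//.
  by rewrite lerXn2r ?nnegrE// (le_trans _ (taut k)).
exists x; split => // k c Ac.
set z : R[i] := T x k - (tau k)%:C%C * T f k.
suff zc : normc z <= c.
  rewrite -(subrK ((tau k)%:C%C * (T f k : R[i])) (T x k)) addrC.
  by rewrite (le_trans (le_normcD _ _))// normcM normc_real lerD2l.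
have FF : ProperFilter (@totally I) := totally_filter.
have near_sum (y : ell2 R I) d : 0 < d -> totally (fun J : {fset I} =>
    normc ((T y k : R[i]) - \sum_(m : J) A k (val m) * y (val m)) < d).
  move=> d0; have d0C : 0 < (d%:C%C : R[i]) by rewrite ltcR.
  have /cvgrPdist_lt/(_ _ d0C) := AT y k.
  apply: filterS => J.
  by rewrite normr_normc ltcR.
apply/ler_addgt0Pr => e e0.
have t0 : 0 <= t by apply: le_trans (taut k).
have t1 : 0 < 1 + t by lra.
(* The series of T x contributes an error d, that of T f an error at most t * d after multiplication
   by tau k; together they make e. *)
have d0 : 0 < e / (1 + t) by rewrite divr_gt0.
set d := e / (1 + t) in d0.
have xfJ := @filterI _ _ FF _ _ (near_sum x d d0) (near_sum f d d0).
have [J [xJ fJ]] := @filter_ex _ _ FF _ xfJ.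
have -> : z = (T x k - \sum_(m : J) A k (val m) * x (val m)) +
   (\sum_(m : J) (A k (val m) * (tau (val m) - tau k)%:C%C * f (val m)) -
   (tau k)%:C%C * (T f k - \sum_(m : J) A k (val m) * f (val m))).
  rewrite mulrBr mulr_sumr.
  have -> : \sum_(m : J) A k (val m) * (tau (val m) - tau k)%:C%C * f (val m)
     = \sum_(m : J) A k (val m) * x (val m)
       - \sum_(m : J) (tau k)%:C%C * (A k (val m) * f (val m)) :> R[i].
    rewrite -sumrB; apply: eq_bigr => m _; rewrite xE rmorphB/=; ring.
  by rewrite /z; ring.
apply: le_trans (le_normcD _ _) _; rewrite addrC.
have -> : c + e = (c + t * d) + d by rewrite /d; field; rewrite gt_eqF.
rewrite lerD ?(ltW xJ)//; apply: le_trans (le_normcD _ _) _.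
rewrite normcN normcM normc_real lerD//; last first.
  by rewrite ler_pM ?normc_ge0 ?(ltW fJ).
pose h m := A k m * (tau m - tau k)%:C%C * f m.
have -> : \sum_(m : J) A k (val m) * (tau (val m) - tau k)%:C%C * f (val m) =
    \sum_(m <- J) h m by rewrite big_seq_fsetE.
apply: le_trans (normc_sum_le _ _) _.
have /sum_leP/(_ J) := Ac; apply: le_trans.
by apply: ler_sum => m _; rewrite !normcM normc_real.
Qed.

End Ell2.

(** * Blocks and weights on the integer lattice *)

Section Pairs.
Context {R : realType}.

Lemma sum_le_pair {I J : choiceType} (f : I -> J -> R) (g : I -> R) c :
  (forall i j, 0 <= f i j) -> (forall i, sum_le (f i) (g i)) -> sum_le g c ->
  sum_le (fun p : I * J => f p.1 p.2) c.
Proof.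
move=> f0 fg gc; rewrite /sum_le /esumR.
have -> : [set: I * J] = [set: I] `*`` (fun=> [set: J]).
  by apply/seteqP; split.
rewrite -(@esum_esum _ _ _ _ _ (fun i j => (f i j)%:E)); last first.
  by move=> i j _ _; rewrite lee_fin.
by apply: le_trans gc; apply: le_esum => i _; exact: fg.
Qed.

Lemma sum_le_fin {T : finType} (f : T -> R) c :
  (forall i, 0 <= f i) -> sum_le f c <-> \sum_i f i <= c.
Proof.
move=> f0; split=> [/sum_leP fc|fc].
  have /= := fc [fset x in enum T]%fset.
  rewrite (big_uniq _ (fset_uniq _))/=; apply: le_trans.
  rewrite le_eqVlt; apply/orP; left.
  by apply/eqP; apply: eq_bigl => i; rewrite !inE mem_enum.
apply/sum_leP => F; apply: le_trans fc.
rewrite (big_uniq _ (fset_uniq _))/= [leRHS](bigID (mem F))/=.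
by rewrite lerDl sumr_ge0.
Qed.

Lemma sum_le_pair_fst {I : choiceType} {J : finType} (f : I -> J -> R) c :
  (forall i j, 0 <= f i j) -> sum_le (fun p : I * J => f p.1 p.2) c ->
  sum_le (fun i => \sum_j f i j) c.
Proof.
move=> f0; rewrite /sum_le /esumR.
have -> : [set: I * J] = [set: I] `*`` (fun=> [set: J]).
  by apply/seteqP; split.
rewrite -(@esum_esum _ _ _ _ _ (fun i j => (f i j)%:E)); last first.
  by move=> i j _ _; rewrite lee_fin.
apply: le_trans; apply: le_esum => i _.
set e := (X in (_ <= X)%E).
have e0 : (0 <= e)%E by apply: esumR_ge0.
case ee : e => [x| |]; last by rewrite ee in e0.
  by rewrite lee_fin; apply/sum_le_fin => //; rewrite /sum_le -/e -ee.
by rewrite leey.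
Qed.

End Pairs.

Section Blocks.
Context {R : realType} {d N : nat}.

(** Division with remainder in each coordinate: the first component indexes a cube of side N+1, the
    second is the position inside it. *)
Definition block_point (p : 'rV[int]_d * {ffun 'I_d -> 'I_N.+1}) : 'rV[int]_d :=
  \row_j (p.1 0 j * N.+1%:Z + (p.2 j)%:Z).

Lemma block_point_bij : bijective block_point.
Proof.
exists (fun m : 'rV[int]_d =>
    (\row_j divz (m 0 j) N.+1 : 'rV[int]_d,
     [ffun j => inord (absz (modz (m 0 j) N.+1))] : {ffun 'I_d -> 'I_N.+1})).
  move=> [n b]; congr pair; [apply/rowP => j|apply/ffunP => j].
    rewrite !mxE /= divzMDl// divz_small ?addr0//.
    by apply/andP; split => //; rewrite ltz_nat /= ltn_ord.
  rewrite !ffunE; apply: val_inj; rewrite /= mxE modzMDl modz_small/=.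
    by rewrite inordK ?ltn_ord.
  exact: ltn_ord.
move=> m; apply/rowP => j; rewrite !mxE /= ffunE inordK.
  by rewrite gez0_abs ?modz_ge0// -divz_eq.
by rewrite -ltz_nat gez0_abs ?modz_ge0// ltz_pmod.
Qed.

Lemma sum_le_blocks (f : 'rV[int]_d -> R) c : (forall x, 0 <= f x) ->
  sum_le f c -> sum_le (fun n => \sum_b f (block_point (n, b))) c.
Proof.
move=> f0 /(sum_le_reindex _ _ block_point_bij) fc.
apply: (@sum_le_pair_fst R _ _
  (fun (n : 'rV[int]_d) (b : {ffun 'I_d -> 'I_N.+1}) =>
    f (block_point (n, b)))) => //.
Qed.

Lemma sum_le_of_blocks (f : 'rV[int]_d -> R) (g : 'rV[int]_d -> R) c :
  (forall x, 0 <= f x) ->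
  (forall n, \sum_b f (block_point (n, b)) <= g n) -> sum_le g c ->
  sum_le f c.
Proof.
move=> f0 fg gc; apply/(sum_le_reindex _ _ block_point_bij).
apply: (@sum_le_mono _ _ _ (fun p => f (block_point (p.1, p.2))) c) => //.
pose h (n : 'rV[int]_d) (b : {ffun 'I_d -> 'I_N.+1}) := f (block_point (n, b)).
apply: (@sum_le_pair R _ _ h _ _ _ _ gc) => n; first by move=> b; exact: f0.
apply/sum_le_fin; first by move=> b; exact: f0.
exact: fg.
Qed.

End Blocks.

(** * Summability of power weights *)

Section Lattice.
Context {R : realType}.

Lemma powRN_le (x y r : R) : 0 < x -> x <= y -> 0 <= r ->
  y `^ (- r) <= x `^ (- r).
Proof.
move=> x0 xy r0; have y0 := lt_le_trans x0 xy.
rewrite !powRN lef_pV2 ?posrE ?powR_gt0//.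
by apply: ge0_ler_powR; rewrite // nnegrE ltW.
Qed.

(** Comparison with a telescoping sum: with s = p - 1 and h n = (n+1)^-s, the term (n+2)^-p is at
    most (h n - h (n+1)) / s. *)
Lemma sum_le_pseries (p : R) : 1 < p ->
  exists c, sum_le (fun n : nat => n.+1%:R `^ (- p)) c.
Proof.
move=> p1; pose s := p - 1; have s0 : 0 < s by rewrite subr_gt0.
pose h n : R := n.+1%:R `^ (- s).
have step n : s * n.+2%:R `^ (- p) <= h n - h n.+1.
  have X0 : 0 < n.+2%:R :> R by rewrite ltr0n.
  have Y0 : 0 < n.+1%:R :> R by rewrite ltr0n.
  have XE : n.+2%:R = n.+1%:R + 1 :> R by rewrite -natr1.
  have -> : - p = - s + -1 by rewrite /s; ring.
  rewrite powRD; last by rewrite (gt_eqF X0) implybT.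
  rewrite powR_inv1 ?(ltW X0)// /h lerBrDr mulrCA.
  rewrite -[X in _ + X]mulr1 -mulrDr.
  have -> : n.+1%:R `^ (- s) = n.+2%:R `^ (- s) * (n.+2%:R / n.+1%:R) `^ s :> R.
    rewrite powRM ?invr_ge0 ?(ltW X0) ?(ltW Y0)// mulrA.
    rewrite -powRD ?(gt_eqF X0) ?implybT//.
    by rewrite addNr powRr0 mul1r -powR_inv1 ?(ltW Y0)// -powRrM mulN1r.
  rewrite ler_wpM2l ?powR_ge0//.
  (* What remains is 1 + s / (n+2) <= ((n+2) / (n+1))^s. It follows from exp x >= 1 + x and ln (1 -
     1 / (n+2)) <= - 1 / (n+2). *)
  rewrite /powR gt_eqF ?divr_gt0//; apply: le_trans (expR_ge1Dx _).
  rewrite addrC lerD2l ler_wpM2l ?(ltW s0)//.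
  rewrite -[n.+2%:R / _]invf_div lnV ?posrE ?divr_gt0// lerNr.
  have -> : n.+1%:R / n.+2%:R = 1 + - n.+2%:R^-1 :> R.
    apply: (mulIf (lt0r_neq0 X0)).
    by rewrite divfK ?gt_eqF// mulrDl mulNr mulVf ?gt_eqF// XE; ring.
  by apply: le_ln1Dx; rewrite ltrN2 invf_lt1// ltr1n.
exists (1 + s^-1); apply/sum_leP => F.
pose n := (\max_(k <- F) k).+1.
apply: (@le_trans _ _ (\sum_(k < n.+1) k.+1%:R `^ (- p))).
  rewrite -(big_mkord xpredT (fun k => k.+1%:R `^ (- p)))/= -lee_fin -!sumEFin.
  apply: (lee_sum_fset_nat F n.+1 xpredT).
    by move=> k _; rewrite lee_fin powR_ge0.
  move=> k /= kF; apply: leqW; rewrite /n ltnS.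
  exact: (@leq_bigmax_seq _ _ xpredT id).
apply: (@le_trans _ _ (1 + s^-1 * (1 - h n))); last first.
  by rewrite lerD2l ger_pMr ?invr_gt0// gerBl powR_ge0.
elim: n => [|n IHn].
  by rewrite big_ord1 /h !powR1 subrr mulr0 addr0.
rewrite big_ord_recr/=; apply: le_trans (lerD IHn (lexx _)) _.
rewrite -addrA lerD2l -lerBDl -mulrBr.
rewrite -(ler_pM2l s0) mulrA divff ?gt_eqF// mul1r.
by apply: le_trans (step n) _; lra.
Qed.

(** [Negz n] is -(n+1), of absolute value n+1, so by monotonicity each half of the integers is
    bounded by the sum over the naturals. *)
Lemma sum_le_int (g : nat -> R) c : (forall n, 0 <= g n) ->
  {homo g : m n / (m <= n)%N >-> n <= m} -> sum_le g c ->
  sum_le (fun t : int => g `|t|%N) (2 * c).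
Proof.
move=> g0 gmon gc.
pose e (p : nat * bool) := if p.2 then Posz p.1 else Negz p.1.
have e_bij : bijective e.
  by exists (fun t => match t with
      | Posz n => (n, true) | Negz n => (n, false) end);
    [case=> n []|case].
apply/(sum_le_reindex _ _ e_bij).
apply: (@sum_le_mono _ _ _ (fun p => g p.1)) => //.
  by move=> [n []]//=; exact: gmon.
apply: (@sum_le_pair _ _ _ (fun n _ => g n) (fun n => 2 * g n)) => //.
  by move=> n; apply/sum_le_fin => //; rewrite big_bool/= mulr2n mulrDl mul1r.
exact: sum_leZ.
Qed.

Lemma sum_le_prod_row (g : int -> R) c d : (forall t, 0 <= g t) ->
  sum_le g c -> sum_le (fun x : 'rV[int]_d => \prod_(j < d) g (x 0 j)) (c ^+ d).
Proof.
move=> g0 gc; elim: d => [|d IHd].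
  apply: (@sum_le_mono _ _ _ (fun x : 'rV[int]_0 => 1) 1) => //.
    by move=> x; rewrite big_ord0.
  by apply: (@sum_le_one _ _ (fun=> 1) (0 : 'rV[int]_0)) => // x;
    rewrite thinmx0 eqxx.
pose e (p : int * 'rV[int]_d) : 'rV[int]_d.+1 :=
  \row_j (if unlift ord0 j is Some i then p.2 0 i else p.1).
have e_bij : bijective e.
  exists (fun x : 'rV[int]_d.+1 =>
    (x 0 ord0, \row_i x 0 (lift ord0 i) : 'rV[int]_d)).
    move=> [t x]; rewrite /e mxE unlift_none; congr pair.
    by apply/rowP => i; rewrite !mxE liftK.
  move=> x; apply/rowP => j; rewrite mxE.
  by case: unliftP => [i ->|->] //=; rewrite mxE.
apply/(sum_le_reindex _ _ e_bij).
apply: (@sum_le_mono _ _ _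
   (fun p : int * 'rV[int]_d => g p.1 * \prod_(j < d) g (p.2 0 j))
   (c * c ^+ d)).
- move=> [t x] /=; rewrite big_ord_recl mxE unlift_none ler_wpM2l//.
  by apply: ler_prod => i _; rewrite g0/= mxE liftK.
- by rewrite exprS.
apply: (@sum_le_pair R _ _ (fun (t : int) (x : 'rV[int]_d) =>
     g t * \prod_(j < d) g (x 0 j))
   (fun t => g t * c ^+ d)).
- by move=> t x; rewrite mulr_ge0// prodr_ge0.
- by move=> t; apply: sum_leZ.
- apply: (@sum_le_mono _ _ _ (fun t => c ^+ d * g t) (c ^+ d * c)).
  + by move=> t; rewrite mulrC.
  + by rewrite mulrC.
  + by apply: sum_leZ => //; rewrite exprn_ge0// (sum_le_ge0 _ gc).
Qed.

End Lattice.

(** * The decay weights and their convolutions *)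

Section Weights.
Context {R : realType} {d : nat}.
Implicit Types (x y alpha : 'rV[int]_d) (r : R).

Definition nm x : R := (norm1 x)%:~R.

Lemma nmE x : nm x = \sum_(j < d) `|x 0 j|%:~R.
Proof. by rewrite /nm /norm1 rmorph_sum. Qed.

Lemma nm_ge0 x : 0 <= nm x.
Proof. by rewrite ler0z sumr_ge0. Qed.

Lemma nmD x y : nm (x + y) <= nm x + nm y.
Proof.
rewrite -intrD ler_int -big_split; apply: ler_sum => j _.
by rewrite mxE ler_normD.
Qed.

Lemma nmN x : nm (- x) = nm x.
Proof. by congr (_%:~R); apply: eq_bigr => j _; rewrite mxE normrN. Qed.

Lemma nmB x y : nm (x - y) = nm (y - x).
Proof. by rewrite -opprB nmN. Qed.

Lemma nm_coord x j : `|x 0 j|%:~R <= nm x.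
Proof. by rewrite ler_int /norm1 (bigD1 j)//= lerDl sumr_ge0. Qed.

Lemma nm1_gt0 x : 0 < 1 + nm x. Proof. by rewrite ltr_pwDl// nm_ge0. Qed.

Definition isodecay r x : R := (1 + nm x) `^ (- r).

Lemma isodecay_gt0 r x : 0 < isodecay r x.
Proof. by rewrite powR_gt0 ?nm1_gt0. Qed.

Lemma isodecay_ge0 r x : 0 <= isodecay r x. Proof. exact: powR_ge0. Qed.

Lemma isodecayB r x y : isodecay r (x - y) = isodecay r (y - x).
Proof. by rewrite /isodecay nmB. Qed.

Lemma isodecay_le r (a : R) x y : 0 <= r -> 0 < a ->
  1 + nm x <= a * (1 + nm y) -> isodecay r y <= a `^ r * isodecay r x.
Proof.
move=> r0 a0 xy.
have := powRN_le (nm1_gt0 x) xy r0.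
rewrite powRM ?(ltW a0) ?(ltW (nm1_gt0 _))// powRN mulrC.
rewrite ler_pdivrMr ?powR_gt0//.
by rewrite mulrC.
Qed.

(** The longer of x - y and y has 1 + norm at least (1 + |x|) / 2, so its weight is at most 2^r
    times that of x, and the other weight remains. Summed over y, this bounds the convolution of the
    weight with itself by a multiple of the weight. *)
Lemma isodecay_quasi r x y : 0 <= r ->
  isodecay r (x - y) * isodecay r y <=
  2 `^ r * isodecay r x * (isodecay r y + isodecay r (x - y)).
Proof.
move=> r0; have xy : nm x <= nm (x - y) + nm y by rewrite -{1}(subrK y x) nmD.
rewrite mulrDr; have [le|/ltW le] := leP (nm (x - y)) (nm y).
  apply: (@le_trans _ _ (2 `^ r * isodecay r x * isodecay r (x - y))).
    rewrite mulrC ler_wpM2r ?isodecay_ge0// isodecay_le//; lra.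
  by rewrite lerDr !mulr_ge0 ?isodecay_ge0 ?powR_ge0.
apply: (@le_trans _ _ (2 `^ r * isodecay r x * isodecay r y)).
  rewrite ler_wpM2r ?isodecay_ge0// isodecay_le//; lra.
by rewrite lerDl !mulr_ge0 ?isodecay_ge0 ?powR_ge0.
Qed.

Definition proddecay alpha x : R :=
  \prod_(j < d) (1 + `|x 0 j|%:~R) ^ (- alpha 0 j).

Lemma decayE r alpha x : decay r alpha x = isodecay r x * proddecay alpha x.
Proof. by []. Qed.

Lemma coord1_gt0 (t : int) : 0 < 1 + `|t|%:~R :> R.
Proof. by rewrite ltr_pwDl// ler0z. Qed.

Lemma proddecay_gt0 alpha x : 0 < proddecay alpha x.
Proof. by apply: prodr_gt0 => j _; rewrite exprz_gt0 ?coord1_gt0. Qed.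

Lemma decay_gt0 r alpha x : 0 < decay r alpha x.
Proof. by rewrite decayE mulr_gt0 ?isodecay_gt0 ?proddecay_gt0. Qed.

(** In each coordinate 1 + |a| <= (1 + |a - b|) (1 + |b|). The constant is 1, so the summability in
    [decay_quasi] comes from the isotropic factor alone. *)
Lemma proddecay_submul alpha x y : (forall j, 0 <= alpha 0 j) ->
  proddecay alpha (x - y) * proddecay alpha y <= proddecay alpha x.
Proof.
move=> alpha0; rewrite -big_split/=; apply: ler_prod => j _.
rewrite mulr_ge0 ?exprz_ge0 ?(ltW (coord1_gt0 _))//=.
have := alpha0 j; case: (alpha 0 j) => // n _.
rewrite -!exprnN -invfM -exprMn lef_pV2 ?posrE ?exprn_gt0 ?mulr_gt0
  ?coord1_gt0//.
rewrite lerXn2r ?nnegrE ?mulr_ge0 ?(ltW (coord1_gt0 _))//.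
rewrite !mxE; set a := x 0 j; set b := y 0 j.
have ab : `|a|%:~R <= `|a - b|%:~R + `|b|%:~R :> R.
  by rewrite -intrD ler_int -{1}(subrK b a) ler_normD.
have a0 : 0 <= `|a - b|%:~R :> R by rewrite ler0z.
have b0 : 0 <= `|b|%:~R :> R by rewrite ler0z.
by have := mulr_ge0 a0 b0; nra.
Qed.

Lemma decay_quasi r alpha x y : 0 <= r -> (forall j, 0 <= alpha 0 j) ->
  decay r alpha (x - y) * decay r alpha y <=
  2 `^ r * decay r alpha x * (isodecay r y + isodecay r (x - y)).
Proof.
move=> r0 alpha0; rewrite !decayE mulrACA.
apply: le_trans
  (ler_pM _ _ (isodecay_quasi _ _ r0) (proddecay_submul _ _ alpha0)) _.
- by rewrite mulr_ge0 ?isodecay_ge0.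
- by rewrite mulr_ge0 ?ltW ?proddecay_gt0.
- by rewrite mulrA -!mulrA; rewrite [_ * proddecay _ _]mulrC.
Qed.

(** Each 1 + |x| is at least 1 + |x_j|, so writing the weight as d equal factors of exponent r / d >
    1 bounds it by a product of one-dimensional summable weights. *)
Lemma sum_le_isodecay r : (1 <= d)%N -> d%:R < r ->
  exists c, sum_le (isodecay r) c.
Proof.
move=> d1 dr; have d0 : 0 < d%:R :> R by rewrite ltr0n.
pose p := r / d%:R; have p1 : 1 < p by rewrite ltr_pdivlMr// mul1r.
have [c pc] := sum_le_pseries p1.
have gc := sum_le_int (fun n => powR_ge0 _ _) _ pc.
have {}gc : sum_le (fun t : int => (`|t|%N.+1%:R : R) `^ (- p)) (2 * c).
  apply: gc => m n mn; apply: powRN_le => //; rewrite ?ltr0n ?ler_nat//.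
  by apply: ltW; apply: lt_trans p1.
exists ((2 * c) ^+ d).
have g0 (t : int) : 0 <= (`|t|%N.+1%:R : R) `^ (- p) by exact: powR_ge0.
apply: sum_le_mono (sum_le_prod_row d g0 gc) => // x.
have -> : isodecay r x = \prod_(j < d) isodecay p x.
  rewrite prodr_const card_ord -powR_mulrn ?isodecay_ge0// /isodecay -powRrM.
  by rewrite /p mulNr divfK ?gt_eqF.
apply: ler_prod => j _; rewrite isodecay_ge0/= powRN_le//.
- by rewrite -natr1 addrC lerD2l natr_absz nm_coord.
- by apply: ltW; apply: lt_trans p1.
Qed.

Lemma sum_le_isodecayB r c x : sum_le (isodecay r) c ->
  sum_le (fun y => isodecay r (x - y)) c.
Proof.
move=> rc; have bij : bijective (fun y => x - y).
  by exists (fun y => x - y) => y; rewrite subKr.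
exact: (sum_le_reindex _ _ bij).1 rc.
Qed.

Lemma sum_le_decay_conv r alpha c x : 0 <= r -> (forall j, 0 <= alpha 0 j) ->
  sum_le (isodecay r) c ->
  sum_le (fun y => decay r alpha (x - y) * decay r alpha y)
         (2 `^ r * (c + c) * decay r alpha x).
Proof.
move=> r0 alpha0 rc.
apply: (@sum_le_mono _ _ _ (fun y => 2 `^ r * decay r alpha x *
   (isodecay r y + isodecay r (x - y))) (2 `^ r * decay r alpha x * (c + c))).
- by move=> y; exact: decay_quasi.
- by rewrite mulrAC.
apply: sum_leZ; first by rewrite mulr_ge0 ?powR_ge0 ?(ltW (decay_gt0 _ _ _)).
by apply: sum_leD => //; exact: sum_le_isodecayB.
Qed.

Lemma decay0 r x : decay r 0 x = isodecay r x.
Proof.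
by rewrite decayE /proddecay big1 ?mulr1// => j _; rewrite mxE oppr0 expr0z.
Qed.

End Weights.

(** * Windows and convolution inequalities *)

Section Windows.
Context {R : realType}.

Lemma sqr_sum_card (T : finType) (f : T -> R) : (forall i, 0 <= f i) ->
  (\sum_i f i) ^+ 2 <= #|T|%:R * \sum_i f i ^+ 2.
Proof.
move=> f0.
have one_sum : sum_le (fun _ : T => 1) (#|T|%:R : R).
  by apply/sum_le_fin => //; rewrite sumr_const.
have sqr_le : sum_le (fun i => 1 * f i ^+ 2) (\sum_i f i ^+ 2).
  rewrite (eq_bigr _ (fun i _ => esym (mul1r (f i ^+ 2)))).
  by apply/sum_le_fin => // i; rewrite mul1r sqr_ge0.
have [fr] := rsum_cauchy_schwarz (fun _ => ler01) f0 (ler0n _ _) one_sum sqr_le.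
apply: le_trans; rewrite lerXn2r ?nnegrE ?sumr_ge0 ?rsum_ge0//.
  by move=> i; rewrite mul1r.
rewrite -(eq_bigr _ (fun i _ => mul1r (f i))).
by apply/sum_le_fin => // i; rewrite mul1r.
Qed.

Lemma ler_half_pow (a b c : R) :
  (forall j, a <= b + c * 2^-1 ^+ j) -> a <= b.
Proof.
move=> H; apply/ler_addgt0Pr => e e0.
have [c0|c0] := leP c 0.
  by have := H 0%N; rewrite expr0; lra.
pose j := Num.bound (c / e).
have := H j; have : c / e < 2 ^+ j by apply: upper_nthrootP.
rewrite ltr_pdivrMr// => cj.
have {}cj : c * 2^-1 ^+ j <= e.
  by rewrite exprVn ler_pdivrMr ?exprn_gt0// mulrC ltW.
lra.
Qed.

Context {d : nat}.
Implicit Types (x y z n l : 'rV[int]_d) (r : R).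

Lemma sum_le_decay_conv2 r (alpha : 'rV[int]_d) (c : R) n l :
  0 <= r -> (forall j, 0 <= alpha 0 j) -> sum_le (@isodecay R d r) c ->
  sum_le (fun m => decay r alpha (n - m) * decay r alpha (m - l))
         (2 `^ r * (c + c) * decay r alpha (n - l)).
Proof.
move=> r0 alpha0 rc.
have bij : bijective (fun y => y + l).
  by exists (fun y => y - l) => y; rewrite (addrK, subrK).
apply/(sum_le_reindex _ _ bij).
apply: sum_le_mono (sum_le_decay_conv (n - l) r0 alpha0 rc) => // y /=.
by rewrite addrK opprD addrA addrAC.
Qed.

Lemma sum_le_isodecay_conv2 r (c : R) n l :
  0 <= r -> sum_le (@isodecay R d r) c ->
  sum_le (fun m => isodecay r (n - m) * isodecay r (m - l))
         (2 `^ r * (c + c) * isodecay r (n - l)).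
Proof.
move=> r0 rc; have := @sum_le_decay_conv2 r 0 c n l r0 _ rc.
rewrite decay0 => H; apply: sum_le_mono (H _) => // [y|j].
  by rewrite !decay0.
by rewrite mxE.
Qed.

(** By induction on j, s n <= 2 D u(n - l) + smax / 2^j, where u is [isodecay r]. Inserting this
    bound in the inequality turns 2 D into at most D + D by the bound on u * u and halves the error;
    the a priori bound [smax] starts the induction. *)
Lemma decay_of_convolution_inequality r (c eps D smax : R) l
    (s : 'rV[int]_d -> R) :
  0 <= r -> sum_le (@isodecay R d r) c -> 0 <= eps -> 0 <= D ->
  eps * c <= 2^-1 -> eps * (2 `^ r * (c + c)) <= 2^-1 ->
  (forall n, 0 <= s n <= smax) ->
  (forall n, s n <= D * isodecay r (n - l) +
                    eps * rsum (fun m => isodecay r (n - m) * s m)) ->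
  forall n, s n <= 2 * D * isodecay r (n - l).
Proof.
move=> r0 rc eps0 D0 epsc epsc2 s0 sH n; apply: (@ler_half_pow _ _ smax) => j.
elim: j n => [|j IHj] n.
  rewrite expr0 mulr1 (le_trans (andP (s0 n)).2)// lerDr.
  by rewrite !mulr_ge0 ?isodecay_ge0.
have smax0 : 0 <= smax by have /andP[] := s0 0; exact: le_trans.
have h0 : 0 <= 2^-1 ^+ j :> R by rewrite exprn_ge0 ?invr_ge0.
set h := 2^-1 ^+ j in IHj h0 *.
have sumY : rsum (fun m => isodecay r (n - m) * s m) <=
    2 * D * (2 `^ r * (c + c) * isodecay r (n - l)) + smax * h * c.
  apply: rsum_le => [m|].
    by rewrite mulr_ge0 ?isodecay_ge0//; case/andP: (s0 m).
  apply: sum_le_mono (sum_leD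
      (sum_leZ (a := 2 * D) _ (sum_le_isodecay_conv2 n l r0 rc))
      (sum_leZ (a := smax * h) _ (sum_le_isodecayB n rc))) => //.
  - move=> m; rewrite [_ * (_ * _)]mulrCA [_ * isodecay r (n - m)]mulrC -mulrDr.
    by rewrite ler_wpM2l ?isodecay_ge0.
  - by rewrite mulr_ge0.
  - by rewrite mulr_ge0.
apply: le_trans (sH n) _; rewrite exprS -/h.
have u0 : 0 <= isodecay r (n - l) :> R by exact: isodecay_ge0.
apply: le_trans (lerD (lexx _) (ler_wpM2l eps0 sumY)) _.
have -> : D * isodecay r (n - l) + eps * (2 * D * (2 `^ r * (c + c) *
    isodecay r (n - l)) + smax * h * c) =
  D * isodecay r (n - l) +
  (eps * (2 `^ r * (c + c))) * (2 * D * isodecay r (n - l)) +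
  eps * c * (smax * h) by ring.
have -> : 2 * D * isodecay r (n - l) + smax * (2^-1 * h) =
   D * isodecay r (n - l) + 2^-1 * (2 * D * isodecay r (n - l)) +
   2^-1 * (smax * h) by field.
by rewrite lerD ?lerD// ler_wpM2r// ?mulr_ge0.
Qed.

Definition window (L r : R) z : R := (L + nm z) `^ (- r).

Lemma window_ge0 L r z : 0 <= window L r z. Proof. exact: powR_ge0. Qed.

Lemma window_le_isodecay L r z : 1 <= L -> 0 <= r ->
  window L r z <= isodecay r z.
Proof. by move=> L1 r0; rewrite powRN_le ?nm1_gt0// lerD2r. Qed.

(** Moving the argument by at most D multiplies L + |z| by at most 1 + D / L, hence changes the
    window by a factor of at most 1 + eta either way. *)
Lemma window_slow (L r eta D : R) y z : 0 < L -> 0 <= r -> nm (y - z) <= D ->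
  (1 + D / L) `^ r <= 1 + eta ->
  `|window L r z - window L r y| <= eta * window L r z.
Proof.
move=> L0 r0 yz Leta; set theta := 1 + D / L in Leta.
have D0 : 0 <= D := le_trans (nm_ge0 _) yz.
have theta0 : 0 < theta by rewrite ltr_pwDl ?divr_ge0 ?(ltW L0).
have Lnm x : 0 < L + nm x :> R by rewrite ltr_pwDl ?nm_ge0.
have le_window x1 x2 : nm (x1 - x2) <= D ->
    window L r x2 <= (1 + eta) * window L r x1.
  move=> x12; apply: (@le_trans _ _ (theta `^ r * window L r x1)); last first.
    by rewrite ler_wpM2r ?window_ge0.
  rewrite -{1}[theta `^ r]invrK -powRN mulrC ler_pdivlMr ?powR_gt0//.
  rewrite /window -powRM ?(ltW (Lnm _)) ?(ltW theta0)//.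
  apply: powRN_le => //.
  have -> : (L + nm x2) * theta = L + D + nm x2 + nm x2 * (D / L).
    by rewrite /theta; field; rewrite gt_eqF.
  have := nmD (R := R) (x1 - x2) x2; rewrite subrK => nm1.
  have : 0 <= nm x2 * (D / L) by rewrite mulr_ge0 ?nm_ge0 ?divr_ge0 ?(ltW L0).
  by move: nm1 x12; set P := nm x2 * _; lra.
have zy : nm (z - y) <= D by rewrite nmB.
have := le_window _ _ yz; have := le_window _ _ zy.
move: (window_ge0 L r y) (window_ge0 L r z).
have eta0 : 0 <= eta.
  rewrite -(lerD2l 1) addr0; apply: le_trans Leta.
  rewrite -(powRr0 theta); apply: ler_powR => //.
  by rewrite lerDl divr_ge0 ?(ltW L0).
set a := window L r y; set b := window L r z => a0 b0 ab ba.
by rewrite ler_norml; apply/andP; split; nra.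
Qed.

Lemma exists_slow_scale (r D eta : R) : 0 < r -> 0 <= D -> 0 < eta ->
  exists2 L, 1 <= L & (1 + D / L) `^ r <= 1 + eta.
Proof.
move=> r0 D0 eta0.
pose theta := (1 + eta) `^ r^-1.
have theta1 : 1 < theta.
  have : 1 `^ r^-1 < theta.
    apply: gt0_ltr_powR; rewrite ?nnegrE ?invr_gt0// ?ltrDl//.
    by rewrite addr_ge0// ltW.
  by rewrite powR1.
(* The second summand alone would give 1 + D / L = theta when D > 0; the added 1 ensures L >= 1. *)
exists (1 + D / (theta - 1)).
  by rewrite lerDl divr_ge0// subr_ge0 ltW.
have -> : 1 + eta = theta `^ r.
  by rewrite /theta -powRrM mulVf ?gt_eqF// powRr1// addr_ge0// ltW.
have t0 : 0 < theta - 1 by rewrite subr_gt0.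
have L0 : 0 < 1 + D / (theta - 1) by rewrite ltr_pwDl// divr_ge0// ltW.
apply: ge0_ler_powR; rewrite ?nnegrE ?(ltW r0)//.
- by rewrite addr_ge0// divr_ge0// ltW.
- by rewrite ltW// (lt_trans ltr01).
rewrite -lerBrDl ler_pdivrMr// mulrDr mulr1 mulrCA divff ?gt_eqF// mulr1.
by rewrite lerDr ltW.
Qed.

(** The quantity is 4^r (N+1)^(d - r): the number of points in a cube against the decay gained
    between distant cubes. It tends to 0 because r > d. *)
Lemma exists_block_size (r delta : R) : d%:R < r -> 0 < delta ->
  exists N : nat, N.+1%:R ^+ d * (4 / N.+1%:R) `^ r <= delta.
Proof.
move=> dr delta0; have rd0 : 0 < r - d%:R by rewrite subr_gt0.
pose X := (4 `^ r / delta) `^ (r - d%:R)^-1.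
have X0 : 0 <= X by exact: powR_ge0.
exists (Num.bound X); set N1 := _.+1.
have N1_gt0 : 0 < N1%:R :> R by rewrite ltr0n.
have XN : X <= N1%:R.
  by rewrite (le_trans (ltW (archi_boundP X0)))// ler_nat.
have : 4 `^ r / delta <= N1%:R `^ (r - d%:R).
  have -> : 4 `^ r / delta = X `^ (r - d%:R).
    by rewrite /X -powRrM mulVf ?gt_eqF// powRr1// divr_ge0 ?powR_ge0// ltW.
  by apply: ge0_ler_powR; rewrite ?nnegrE// ltW.
rewrite ler_pdivrMr// powRB; last by rewrite (gt_eqF N1_gt0) implybT.
rewrite powR_mulrn ?(ltW N1_gt0)// mulrAC ler_pdivlMr ?exprn_gt0// => H.
rewrite powRM ?invr_ge0 ?ler0n// -[N1%:R^-1]powR_inv1 ?ler0n// -powRrM mulN1r.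
rewrite powRN mulrA ler_pdivrMr ?powR_gt0// mulrC [leRHS]mulrC.
exact: H.
Qed.

End Windows.

(** * Distances between points and between their cubes *)

Section BlockGeometry.
Context {R : realType} {d N : nat}.
Implicit Types (n : 'rV[int]_d) (b : {ffun 'I_d -> 'I_N.+1}).

Lemma block_point_dist n n' b b' :
  `|nm (block_point (n, b) - block_point (n', b')) - N.+1%:R * nm (n - n')| <=
  (d * N.+1)%:R :> R.
Proof.
rewrite !nmE mulr_sumr -sumrB; apply: le_trans (ler_norm_sum _ _ _) _.
have -> : (d * N.+1)%:R = \sum_(j < d) N.+1%:R :> R.
  by rewrite sumr_const card_ord natrM mulr_natl.
apply: ler_sum => j _; rewrite !mxE /=.
set t := n 0 j; set t' := n' 0 j.
have -> : N.+1%:R * `|t - t'|%:~R = `|N.+1%:Z * (t - t')|%:~R :> R.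
  by rewrite normrM intrM.
rewrite -rmorphB -intr_norm -[leRHS]/(N.+1%:Z%:~R) ler_int.
apply: le_trans (ler_dist_dist _ _) _.
have := ltn_ord (b j); have := ltn_ord (b' j).
move: (nat_of_ord (b j)) (nat_of_ord (b' j)) => u v; lia.
Qed.

(** Valid for every pair of cubes, this turns decay in the cube indices back into decay in the
    points. *)
Lemma block_point_near n n' b b' :
  1 + nm (block_point (n, b) - block_point (n', b')) <=
  (N.+1 * d.+1)%:R * (1 + nm (n - n')) :> R.
Proof.
have := block_point_dist n n' b b'; rewrite ler_norml => /andP[_].
have := @nm_ge0 R d (n - n').
move: (@nm R d (n - n')) (@nm R d _) => x y x0; rewrite !natrM -!natr1.
have N0 : 0 <= N%:R :> R by []. have d0 : 0 <= d%:R :> R by [].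
move: (N%:R : R) (d%:R : R) N0 d0 => u v u0 v0.
have vx := mulr_ge0 v0 x0; have uvx := mulr_ge0 u0 vx; nra.
Qed.

(** The points are at distance at least (N+1) (|n - n'| - d), which is at least (N+1) |n - n'| / 2
    when |n - n'| >= 2 d. A second factor 2 absorbs the 1 in 1 + |n - n'|. *)
Lemma isodecay_block_far r n n' b b' : (1 <= d)%N -> 0 <= r ->
  (2 * d)%:R <= nm (n - n') :> R ->
  isodecay r (block_point (n, b) - block_point (n', b')) <=
  (4 / N.+1%:R) `^ r * isodecay r (n - n') :> R.
Proof.
move=> d1 r0 far; apply: isodecay_le => //.
rewrite mulrAC ler_pdivlMr ?ltr0n//.
have := block_point_dist n n' b b'; rewrite ler_norml => /andP[+ _].
move: far; rewrite !natrM => far.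
have d1R : 1 <= d%:R :> R by rewrite ler1n.
have N1R : 1 <= N.+1%:R :> R by rewrite ler1n.
set x := @nm R d (n - n') in far *; set y := @nm R d _.
move: (N.+1%:R : R) (d%:R : R) d1R N1R far => u v v1 u1 vx xy.
have : 0 <= u * (x - 2 * v) by apply: mulr_ge0; lra.
have : 0 <= u * (v - 1) by apply: mulr_ge0; lra.
nra.
Qed.

End BlockGeometry.

(** * Isotropic decay *)

Section Isotropic.
Context {R : realType} {d : nat}.
Local Notation Zd := 'rV[int]_d.
Local Notation vec := (ell2 R 'rV[int]_d).

Definition block_sum (N : nat) (F : Zd -> R) (n : Zd) : R :=
  \sum_b F (@block_point d N (n, b)).

Lemma isodecay_le1 (r : R) (x : Zd) : 0 <= r -> isodecay r x <= 1.
Proof.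
move=> r0; have : (1 + nm x) `^ (- r) <= 1 `^ (- r).
  by apply: powRN_le => //; rewrite lerDl nm_ge0.
by rewrite powR1.
Qed.

Lemma sum_le_isodecay_col (r c C : R) (m : Zd) : 0 <= C ->
  sum_le (@isodecay R d r) c ->
  sum_le (fun k => C * isodecay r (k - m)) (C * c).
Proof.
move=> C0 rc; apply: sum_leZ => //.
by apply: sum_le_mono (sum_le_isodecayB m rc) => // k; rewrite isodecayB.
Qed.

Lemma sqr_sum3_le (a b c : R) :
  (a + b + c) ^+ 2 <= 3 * (a ^+ 2 + b ^+ 2 + c ^+ 2).
Proof.
have := sqr_ge0 (a - b); have := sqr_ge0 (b - c); have := sqr_ge0 (a - c); nra.
Qed.

(** The multiplier tau is a window centred at cube n and constant on cubes. T (tau f) is bounded by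
    a point mass at l, a commutator part from cubes at index distance below 2 d, and one from the
    remaining cubes. Since tau = L^-r on cube n, the norm of tau f controls f there. *)
Lemma block_sum_estimate (A : Zd -> Zd -> R[i]) (T : {linear vec -> vec})
    (f : vec) (r M C c eta L : R) (N : nat) (l q : Zd)
    (b0 : {ffun 'I_d -> 'I_N.+1}) :
  (1 <= d)%N -> 0 < r -> 0 < M -> 0 < C -> 0 < eta -> 1 <= L ->
  sum_le (@isodecay R d r) c ->
  (forall k m, normc (A k m) <= C * isodecay r (k - m)) ->
  induces A T -> (forall x, ell2norm x <= M * ell2norm (T x)) ->
  T f = unit_vec R l -> l = block_point (q, b0) ->
  (1 + (2 * d)%:R / L) `^ r <= 1 + eta -> 3 * (M * eta * C * c) <= 1 ->
  let s := block_sum N (fun k => normc (f k)) in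
  let E := 3 * M * L `^ r * N.+1%:R ^+ d in
  forall n, s n <= E * isodecay r (n - q) +
    E * (C * (4 / N.+1%:R) `^ r * (c + 2 `^ r * (c + c))) *
    rsum (fun m => isodecay r (n - m) * s m).
Proof.
move=> d1 r0 M0 C0 eta0 L1 rc AC AT Tinv Tf lE Leta smalleta s E n.
have L0 : 0 < L by exact: lt_le_trans L1.
have [g gK Kg] := @block_point_bij d N.
pose F k := normc (f k).
have F0 k : 0 <= F k by exact: normc_ge0.
have s0 m : 0 <= s m by apply: sumr_ge0 => b _; exact: F0.
have c0 : 0 <= c by apply: sum_le_ge0 rc => m; exact: isodecay_ge0.
pose w z := @window R d L r z.
have w0 z : 0 <= w z by exact: window_ge0.
have wu z : w z <= isodecay r z by apply: window_le_isodecay => //; exact: ltW.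
have w1 z : w z <= 1 by apply: le_trans (wu z) (isodecay_le1 _ (ltW r0)).
pose tau k := w ((g k).1 - n).
have tau0 k : 0 <= tau k by exact: w0.
have [|x [xE Tx]] := @commutator_bound R _ A T f tau 1 AT.
  by move=> k; rewrite ger0_norm ?tau0 //; exact: w1.
have xF k : normc (x k) = tau k * F k.
  by rewrite xE normcM normc_real ger0_norm.
pose G := ell2norm x ^+ 2.
have G0 : 0 <= G by exact: sqr_ge0.
have tauFG : sum_le (fun k => (tau k * F k) ^+ 2) G.
  by apply: sum_le_mono (sum_le_ell2norm x) => // k; rewrite xF.
have tauF0 k : 0 <= tau k * F k by rewrite mulr_ge0.
have Cu0 (k m : Zd) : 0 <= C * isodecay r (k - m) :> R.
  by rewrite mulr_ge0 ?isodecay_ge0 ?(ltW C0).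
have Cc0 : 0 <= C * c by rewrite mulr_ge0 ?(ltW C0).
have Crow (k : Zd) : sum_le (fun m => C * isodecay r (k - m)) (C * c).
  apply: sum_leZ; [exact: ltW|exact: (sum_le_isodecayB k rc)].
have Ccol (m : Zd) : sum_le (fun k => C * isodecay r (k - m)) (C * c).
  by apply: sum_le_isodecay_col => //; exact: ltW.
(* The near part will be at most eta * e1, and by Schur's test e1 has l^2 norm at most C c times
   that of tau f itself; this makes absorption possible. *)
have [near_sum near_sqr] := @schur_test R Zd Zd
   (fun k m => C * isodecay r (k - m)) (fun m => tau m * F m) _ _ G
   Cu0 tauF0 Cc0 Cc0 Crow Ccol tauFG.
set e1 := fun k => rsum (fun m => C * isodecay r (k - m) * (tau m * F m)).
rewrite -/e1 in near_sqr.
pose aN : R := (4 / N.+1%:R) `^ r.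
have aN0 : 0 <= aN by exact: powR_ge0.
(* Kernel for distant cubes p and m. No cancellation is used there: the difference of two windows is
   bounded by their sum. *)
pose K p m : R := C * aN * isodecay r (p - m) * (w (p - n) + w (m - n)).
have K0 p m : 0 <= K p m.
  by rewrite mulr_ge0 ?addr_ge0// mulr_ge0 ?isodecay_ge0// mulr_ge0 ?(ltW C0).
pose c3 := c + 2 `^ r * (c + c).
have c30 : 0 <= c3 by rewrite addr_ge0// mulr_ge0 ?powR_ge0 ?addr_ge0.
have F_le k : F k <= ell2norm f by exact: normc_le_ell2norm.
pose smax : R := \sum_(b : {ffun 'I_d -> 'I_N.+1}) ell2norm f.
have s_le m : s m <= smax by apply: ler_sum => b _; exact: F_le.
pose Y := rsum (fun m => isodecay r (n - m) * s m).
have us0 m : 0 <= isodecay r (n - m) * s m by rewrite mulr_ge0 ?isodecay_ge0.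
have Ysum : sum_le (fun m => isodecay r (n - m) * s m) Y.
  apply: (@sum_le_rsum _ _ _ (smax * c)) => //.
  apply: (@sum_le_mono _ _ _
    (fun m => smax * isodecay r (n - m)) (smax * c)) => //.
    by move=> m; rewrite mulrC ler_wpM2r ?isodecay_ge0.
  apply: sum_leZ; first by apply: le_trans (s0 n) (s_le n).
  exact: (sum_le_isodecayB _ rc).
(* Summing over p, the window at m gives u(n - m) times c, while the window at p gives a convolution
   u * u; [c3] adds the two constants. *)
have Kcol m : sum_le (K ^~ m) (C * aN * c3 * isodecay r (n - m)).
  rewrite -mulrA; apply: (@sum_le_mono _ _ _ (fun p => C * aN *
     (isodecay r (n - m) * isodecay r (p - m) +
      isodecay r (n - p) * isodecay r (p - m)))
     (C * aN * (isodecay r (n - m) * c +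
       2 `^ r * (c + c) * isodecay r (n - m)))).
  - move=> p; rewrite /K -mulrA ler_wpM2l// ?mulr_ge0 ?(ltW C0)//.
    rewrite mulrDr addrC lerD//.
      rewrite mulrC ler_wpM2r ?isodecay_ge0//.
      by apply: le_trans (wu _) _; rewrite isodecayB.
    rewrite mulrC ler_wpM2r ?isodecay_ge0//.
    by apply: le_trans (wu _) _; rewrite isodecayB.
  - by rewrite /c3 mulrDl [c * _]mulrC.
  apply: sum_leZ; first by rewrite mulr_ge0 ?(ltW C0).
  apply: sum_leD; last exact: sum_le_isodecay_conv2 (ltW r0) rc.
  by apply: sum_le_isodecay_col => //; exact: isodecay_ge0.
(* For sequences the l^2 norm is at most the l^1 norm, so the contribution of
   distant blocks may be summed over p before squaring. *)
have [far_sum far_tot] : (forall p, sum_le (fun m => K p m * s m)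
      (rsum (fun m => K p m * s m))) /\
    sum_le (fun p => rsum (fun m => K p m * s m)) (C * aN * c3 * Y).
  apply: (@sum_le_exchange _ _ _ (fun p m => K p m * s m)
     (fun m => C * aN * c3 * (isodecay r (n - m) * s m))).
  - by move=> p m; rewrite mulr_ge0.
  - move=> m; apply: (@sum_le_mono _ _ _ (fun p => s m * K p m)
      (s m * (C * aN * c3 * isodecay r (n - m)))).
    + by move=> p; rewrite mulrC.
    + by rewrite mulrC -!mulrA.
    + exact: sum_leZ.
  - by apply: sum_leZ => //; rewrite !mulr_ge0 ?(ltW C0).
set h := fun p => rsum (fun m => K p m * s m) in far_tot.
have h0 p : 0 <= h p by apply: rsum_ge0 => m; rewrite mulr_ge0.
have e10 k : 0 <= e1 k by apply: rsum_ge0 => m; rewrite mulr_ge0.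
have TxE k : normc (T x k) <=
    tau k * (k == l)%:R + (eta * e1 k + h (g k).1).
  have -> : (k == l)%:R = normc (T f k).
    rewrite Tf /= /delta; case: eqP => _; [exact/esym/normc1|exact/esym/normc0].
  rewrite -{1}[tau k]ger0_norm//; apply: Tx.
  apply: (@sum_le_mono _ _ _ (fun m =>
     eta * (C * isodecay r (k - m) * (tau m * F m)) + K (g k).1 (g m).1 * F m)
     (eta * e1 k + h (g k).1)) => //; last first.
    apply: sum_leD; first by apply: sum_leZ; [exact: ltW|exact: near_sum].
    apply: (@sum_le_of_blocks _ _ N _ (fun m => K (g k).1 m * s m)).
    - by move=> m; rewrite mulr_ge0.
    - move=> m; rewrite mulr_sumr; apply: ler_sum => b _.
      by rewrite gK.
    - exact: far_sum.
  move=> m; have u0 : 0 <= isodecay r (k - m) :> R by exact: isodecay_ge0.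
  have [far|near] := leP ((2 * d)%:R) (@nm R d ((g k).1 - (g m).1)).
    rewrite -[leLHS]add0r lerD//.
      by rewrite mulr_ge0 ?(ltW eta0)// mulr_ge0.
    rewrite /K; apply: ler_wpM2r; first exact: F0.
    apply: ler_pM; rewrite ?normc_ge0//.
      apply: le_trans (AC k m) _; rewrite -mulrA ler_wpM2l ?(ltW C0)//.
      have := @isodecay_block_far R d N r (g k).1 (g m).1 (g k).2 (g m).2 d1
        (ltW r0) far.
      by rewrite -!surjective_pairing !Kg.
    rewrite ler_norml /tau.
    by have := w0 ((g k).1 - n); have := w0 ((g m).1 - n); lra.
  rewrite -[leLHS]addr0 lerD//; last exact: mulr_ge0.
  rewrite [leRHS]mulrCA -mulrA; apply: ler_pM; rewrite ?mulr_ge0 ?normc_ge0//.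
  rewrite mulrA; apply: ler_wpM2r; [exact: F0|rewrite /tau].
  apply: (@window_slow _ _ _ _ _ (2 * d)%:R) => //; first exact: ltW.
  by rewrite opprB addrA subrK; exact: ltW.
pose P := C * aN * c3 * Y.
have Y0 : 0 <= Y by exact: rsum_ge0.
have P0 : 0 <= P by rewrite !mulr_ge0 ?(ltW C0).
pose V : R := N.+1%:R ^+ d.
have V1 : 1 <= V by rewrite exprn_ege1// ler1n.
have V0 : 0 <= V by exact: le_trans V1.
(* The far bound is constant on each cube, so passing from cubes to points costs V, the number of
   points in a cube. *)
have hsum : sum_le (fun k => h (g k).1 ^+ 2) (V * P ^+ 2).
  apply: (@sum_le_of_blocks _ _ N _ (fun p => V * h p ^+ 2)).
  - by move=> z; exact: sqr_ge0.
  - move=> p; rewrite (eq_bigr (fun=> h p ^+ 2)) => [|b _]; last by rewrite gK.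
    by rewrite sumr_const card_ffun !card_ord -mulr_natl natrX.
  - by apply: sum_leZ => //; exact: sum_le_sqr.
have deltasum : sum_le (fun k => (tau k * (k == l)%:R) ^+ 2) (tau l ^+ 2).
  have := @sum_le_one R _ (fun k => (tau k * (k == l)%:R) ^+ 2) l.
  rewrite eqxx mulr1; apply; last exact: sqr_ge0.
  by move=> k /negbTE->; rewrite mulr0 expr0n.
pose X := 3 * (tau l ^+ 2 + eta ^+ 2 * (C * c * (C * c) * G) + V * P ^+ 2).
have TxX : sum_le (fun k => normc (T x k) ^+ 2) X.
  apply: sum_le_mono (sum_leZ (ler0n R 3) (sum_leD (sum_leD deltasum
    (sum_leZ (sqr_ge0 eta) near_sqr)) hsum)) => // k.
  apply: le_trans
    (_ : (tau k * (k == l)%:R + eta * e1 k + h (g k).1) ^+ 2 <= _).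
    rewrite lerXn2r ?nnegrE ?normc_ge0//.
      by rewrite !addr_ge0 ?mulr_ge0 ?(ltW eta0).
    by rewrite -addrA; exact: TxE.
  by apply: le_trans (sqr_sum3_le _ _ _) _; rewrite [(eta * _) ^+ 2]exprMn.
have X0 : 0 <= X by apply: sum_le_ge0 TxX => k; exact: sqr_ge0.
have GX : G <= M ^+ 2 * X.
  rewrite /G -[X]sqr_sqrtr// -exprMn lerXn2r ?nnegrE ?ell2norm_ge0//.
    by rewrite mulr_ge0 ?(ltW M0)// sqrtr_ge0.
  apply: le_trans (Tinv x) _; rewrite ler_wpM2l ?(ltW M0)//.
  by apply: ell2norm_le; rewrite ?sqrtr_ge0// sqr_sqrtr.
(* The near part contributes 3 (M eta C c)^2 G <= G / 3 to the right-hand side. As G is finite, it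
   can be absorbed by the left-hand side. *)
have {GX} G_le : G <= 9 * M ^+ 2 * (tau l ^+ 2 + V * P ^+ 2).
  have small2 : 9 * (M * eta * C * c) ^+ 2 <= 1.
    have -> : 9 * (M * eta * C * c) ^+ 2 = (3 * (M * eta * C * c)) ^+ 2 by ring.
    by rewrite expr_le1// !mulr_ge0 ?(ltW M0) ?(ltW C0) ?(ltW eta0).
  have XE : M ^+ 2 * X = 3 * M ^+ 2 * (tau l ^+ 2 + V * P ^+ 2) +
     3 * (M * eta * C * c) ^+ 2 * G by rewrite /X; ring.
  have : 9 * (M * eta * C * c) ^+ 2 * G <= G by rewrite -[leRHS]mul1r ler_wpM2r.
  have : 0 <= M ^+ 2 * (tau l ^+ 2 + V * P ^+ 2).
    by rewrite mulr_ge0 ?sqr_ge0// addr_ge0 ?sqr_ge0// mulr_ge0 ?sqr_ge0.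
  move: GX; rewrite XE; lra.
have taul : tau l <= isodecay r (n - q).
  by rewrite /tau lE gK isodecayB; exact: wu.
have sqF : \sum_(b : {ffun 'I_d -> 'I_N.+1}) F (block_point (n, b)) ^+ 2 <=
    (L `^ r) ^+ 2 * G.
  have := sum_le_term n (sum_le_blocks (N := N) (fun k => sqr_ge0 _) tauFG).
  move=> /(ler_wpM2l (sqr_ge0 (L `^ r))); apply: le_trans.
  rewrite mulr_sumr; apply: ler_sum => b _.
  rewrite /tau gK /= subrr /w /window [nm 0]nmE big1; last first.
    by move=> j _; rewrite mxE normr0.
  rewrite addr0 -exprMn mulrA powRN divff ?mul1r// gt_eqF// powR_gt0//.
(* Cauchy-Schwarz over the V points of cube n passes from the l^2 norm back to the l^1 norm. *)
have sn2 : s n ^+ 2 <= V * ((L `^ r) ^+ 2 * G).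
  apply: le_trans (sqr_sum_card _) _ => [b|]; first exact: F0.
  by rewrite card_ffun !card_ord natrX ler_wpM2l.
have E0 : 0 <= E by rewrite !mulr_ge0 ?powR_ge0 ?(ltW M0).
have u0 : 0 <= isodecay r (n - q) :> R by exact: isodecay_ge0.
have -> : E * (C * (4 / N.+1%:R) `^ r * (c + 2 `^ r * (c + c))) *
  rsum (fun m => isodecay r (n - m) * s m) = E * P.
  by rewrite /P /Y /c3 /aN; ring.
have EuP0 : 0 <= E * (isodecay r (n - q) + P).
  exact: mulr_ge0 E0 (addr_ge0 u0 P0).
have sn0 := s0 n.
rewrite -mulrDr -(ler_pXn2r (n := 2)) ?nnegrE//.
apply: le_trans sn2 _.
apply: le_trans (_ : V * ((L `^ r) ^+ 2 *
    (9 * M ^+ 2 * (isodecay r (n - q) ^+ 2 + V * P ^+ 2))) <= _).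
  rewrite ler_wpM2l// ler_wpM2l ?sqr_ge0//; apply: le_trans G_le _.
  apply: ler_wpM2l; first by rewrite mulr_ge0 ?sqr_ge0.
  by apply: lerD => //; rewrite lerXn2r ?nnegrE.
have -> : V * ((L `^ r) ^+ 2 *
    (9 * M ^+ 2 * (isodecay r (n - q) ^+ 2 + V * P ^+ 2))) =
   (3 * M * L `^ r) ^+ 2 * (V * isodecay r (n - q) ^+ 2 + V ^+ 2 * P ^+ 2).
  by ring.
have -> : (E * (isodecay r (n - q) + P)) ^+ 2 = (3 * M * L `^ r) ^+ 2 *
   (V ^+ 2 * (isodecay r (n - q) + P) ^+ 2) by rewrite /E -/V; ring.
rewrite ler_wpM2l ?sqr_ge0//.
(* Since V >= 1, the single factor V in [E] serves both the point mass and the far part. *)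
have VV : V <= V ^+ 2 by rewrite expr2 ler_peMr.
apply: le_trans (_ : V ^+ 2 * (isodecay r (n - q) ^+ 2 + P ^+ 2) <= _).
  by rewrite mulrDr lerD2r ler_wpM2r ?sqr_ge0.
rewrite ler_wpM2l ?sqr_ge0// sqrrD.
by have := mulr_ge0 u0 P0; lra.
Qed.

(** The constants are fixed in the order eta, L, N: eta makes the near part absorbable, L makes the
    window slow over distance 2 d, and N makes eps small. The last choice is not circular, since eps
    is (N+1)^d (4 / (N+1))^r times [E0], which does not depend on N. *)
Theorem jaffard (A : Zd -> Zd -> R[i]) (S T : {linear vec -> vec}) (r C : R) :
  (1 <= d)%N -> d%:R < r -> 0 < C ->
  (forall k m, normc (A k m) <= C * isodecay r (k - m)) ->
  induces A T -> bounded_op S -> cancel T S -> cancel S T ->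
  exists C', 0 < C' /\
    forall k l, normc (entry S k l) <= C' * isodecay r (k - l).
Proof.
move=> d1 dr C0 AC AT [M0 SM0] TK SK.
have r0 : 0 < r by apply: le_lt_trans dr.
(* The constant in [bounded_op] carries no sign, so it is replaced by a positive one. *)
pose M := `|M0| + 1.
have M_gt0 : 0 < M by rewrite ltr_wpDl.
have SM x : ell2norm (S x) <= M * ell2norm x.
  apply: le_trans (SM0 x) _; rewrite ler_wpM2r ?ell2norm_ge0//.
  by rewrite (le_trans (ler_norm _))// lerDl.
have Tinv x : ell2norm x <= M * ell2norm (T x) by rewrite -{1}(TK x).
have [c rc] := sum_le_isodecay (R := R) d1 dr.
have c1 : 1 <= c.
  have := sum_le_term 0 rc; rewrite /isodecay nmE big1 ?addr0 ?powR1//.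
  by move=> j _; rewrite mxE normr0.
have c_gt0 : 0 < c by exact: lt_le_trans c1.
pose eta := (3 * (M * C * c))^-1.
have MCc : 0 < 3 * (M * C * c) by rewrite !mulr_gt0.
have eta0 : 0 < eta by rewrite invr_gt0.
have smalleta : 3 * (M * eta * C * c) <= 1.
  have -> : 3 * (M * eta * C * c) = eta * (3 * (M * C * c)) by ring.
  by rewrite /eta mulVf ?gt_eqF.
have [L L1 Leta] := exists_slow_scale r0 (ler0n R (2 * d)) eta0.
pose c3 := c + 2 `^ r * (c + c).
have c2_ge0 : 0 <= 2 `^ r * (c + c).
  by rewrite mulr_ge0 ?powR_ge0 ?addr_ge0 ?ltW.
have c3_gt0 : 0 < c3 by rewrite ltr_wpDr.
have Lr : 0 < L `^ r by rewrite powR_gt0// (lt_le_trans _ L1).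
pose E0 := 3 * M * L `^ r * C * c3.
have E0_gt0 : 0 < E0 by rewrite !mulr_gt0.
have delta0 : 0 < (2 * E0 * c3)^-1 by rewrite invr_gt0 !mulr_gt0.
have [N N_small] := exists_block_size dr delta0.
pose E := 3 * M * L `^ r * N.+1%:R ^+ d.
pose eps := E * (C * (4 / N.+1%:R) `^ r * c3).
have E_gt0 : 0 < E by rewrite !mulr_gt0 ?exprn_gt0.
have eps0 : 0 <= eps by rewrite !mulr_ge0 ?powR_ge0 ?(ltW _).
(* As [c3] is the sum of c and 2^r (c + c), this gives both smallness conditions of the iteration at
   once. *)
have eps_small : eps * c3 <= 2^-1.
  have -> : eps * c3 = E0 * c3 * (N.+1%:R ^+ d * (4 / N.+1%:R) `^ r).
    by rewrite /eps /E /E0; ring.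
  have E0c3 : 0 < E0 * c3 by rewrite mulr_gt0.
  apply: le_trans (ler_wpM2l (ltW E0c3) N_small) _.
  by rewrite -[2 * E0 * c3]mulrA invfM mulrCA divff ?mulr1 ?gt_eqF.
have [g gK Kg] := @block_point_bij d N.
pose D := (N.+1 * d.+1)%:R `^ r : R.
exists (2 * E * D); split.
  by rewrite mulr_gt0 ?mulr_gt0 // powR_gt0 ?ltr0n ?muln_gt0.
move=> k l; pose f := S (unit_vec R l).
pose s := block_sum N (fun k => normc (f k)).
have s0 n : 0 <= s n by apply: sumr_ge0 => b _; exact: normc_ge0.
have sE n : s n <= E * isodecay r (n - (g l).1) +
    eps * rsum (fun m => isodecay r (n - m) * s m).
  apply: (@block_sum_estimate A T f r M C c eta L N l _ (g l).2) => //.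
    by rewrite /f SK.
  by rewrite -surjective_pairing Kg.
pose smax : R := \sum_(b : {ffun 'I_d -> 'I_N.+1}) ell2norm f.
have s_le n : 0 <= s n <= smax.
  by rewrite s0 /=; apply: ler_sum => b _; exact: normc_le_ell2norm.
have eps_c : eps * c <= 2^-1.
  by apply: le_trans eps_small; rewrite ler_wpM2l// lerDl.
have eps_c2 : eps * (2 `^ r * (c + c)) <= 2^-1.
  by apply: le_trans eps_small; rewrite ler_wpM2l// lerDr ltW.
have s_decay := decay_of_convolution_inequality (ltW r0) rc eps0 (ltW E_gt0)
  eps_c eps_c2 s_le sE.
apply: le_trans (_ : s (g k).1 <= _).
  rewrite /s /block_sum (bigD1 (g k).2)//= -surjective_pairing Kg lerDl.
  by apply: sumr_ge0 => b _; exact: normc_ge0.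
apply: le_trans (s_decay _) _; rewrite -[leRHS]mulrA; apply: ler_wpM2l.
  by rewrite mulr_ge0// ltW.
apply: isodecay_le; rewrite ?(ltW r0)//.
have := @block_point_near R d N (g k).1 (g l).1 (g k).2 (g l).2.
by rewrite -!surjective_pairing !Kg.
Qed.

End Isotropic.

(** * Product weights *)

Section Anisotropic.
Context {R : realType} {d : nat}.
Local Notation Zd := 'rV[int]_d.
Local Notation vec := (ell2 R 'rV[int]_d).
Implicit Types (alpha beta gamma x : Zd).

Lemma decay_anti (r : R) alpha beta x : (forall j, beta 0 j <= alpha 0 j) ->
  decay r alpha x <= decay r beta x.
Proof.
move=> ba; rewrite !decayE ler_wpM2l ?isodecay_ge0//.
apply: ler_prod => j _; rewrite exprz_ge0 ?(ltW (coord1_gt0 _))//=.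
by rewrite ler_weXz2l ?lerN2// lerDl ler0z.
Qed.

Lemma decay_delta (r : R) beta x j :
  decay r (beta - delta_mx 0 j) x = (1 + `|x 0 j|%:~R) * decay r beta x.
Proof.
rewrite !decayE mulrCA; congr (_ * _).
rewrite /proddecay (bigD1 j)//= [in RHS](bigD1 j)//= mulrA; congr (_ * _).
  rewrite !mxE !eqxx opprB addrC expfzDr ?expr1z//.
by apply: eq_bigr => i ij; rewrite !mxE eqxx (negbTE ij) subr0.
Qed.

(* Entrywise form of D_j B = - B (D_j A) B.  The multiplier |m_j - l_j| is
   truncated at its value for m = k, so that column l stays in l^2. *)
Lemma derivation_bound (A : Zd -> Zd -> R[i]) (S T : {linear vec -> vec})
    (r C C1 c : R) gamma (j : 'I_d) :
  0 <= r -> (forall i, 0 <= gamma 0 i) -> sum_le (@isodecay R d r) c ->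
  induces A T -> bounded_op S -> cancel T S -> cancel S T ->
  0 <= C -> 0 <= C1 ->
  (forall k m : Zd, normc (A k m) * `|k 0 j - m 0 j|%:~R <=
     C * decay r gamma (k - m)) ->
  (forall k m, normc (entry S k m) <= C1 * decay r gamma (k - m)) ->
  forall k l : Zd, `|k 0 j - l 0 j|%:~R * normc (entry S k l) <=
    C1 * (C * C1) * (2 `^ r * (c + c)) ^+ 2 * decay r gamma (k - l).
Proof.
move=> r0 gamma0 rc AT [M SM] TK SK C0 C10 AC SC k l.
pose cc := 2 `^ r * (c + c); rewrite -/cc.
pose K : R := `|k 0 j - l 0 j|%:~R.
pose tau (m : Zd) : R := Num.min `|m 0 j - l 0 j|%:~R K.
have K0 : 0 <= K by rewrite ler0z.
have tau0 m : 0 <= tau m by rewrite le_min ler0z K0 normr_ge0.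
have tauK m : `|tau m| <= K by rewrite ger0_norm ?ge_min ?lexx ?orbT.
have [x [xE Tx]] := @commutator_bound R _ A T (S (unit_vec R l)) tau K AT tauK.
(* Truncating by a minimum keeps the multiplier 1-Lipschitz in coordinate j, so the commutator is
   still dominated by D_j A. *)
have tau_lip (m n : Zd) : `|tau m - tau n| <= `|n 0 j - m 0 j|%:~R.
  have H : `|(`|m 0 j - l 0 j|%:~R : R) - `|n 0 j - l 0 j|%:~R| <=
     `|n 0 j - m 0 j|%:~R.
    rewrite -intrB -intr_norm ler_int.
    by apply: le_trans (ler_dist_dist _ _) _; lia.
  move: H; rewrite /tau; set a : R := `|m 0 j - l 0 j|%:~R.
  set b : R := `|n 0 j - l 0 j|%:~R; rewrite !ler_norml => /andP[H1 H2].
  have [aK|aK] := leP a K; have [bK|bK] := leP b K; apply/andP; split; lra.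
have dg0 z : 0 <= decay r gamma z :> R by rewrite ltW ?decay_gt0.
have Txn n : normc (T x n) <= C * C1 * cc * decay r gamma (n - l).
  have := Tx n (C * C1 * cc * decay r gamma (n - l)).
  rewrite SK /= /delta.
  (* Here T f is the unit vector at l and tau vanishes at l, so only the commutator survives. *)
  have -> : `|tau n| * normc (n == l)%:R = 0.
    have [->|_] := eqVneq n l; last by rewrite normc0 mulr0.
    by rewrite /tau subrr normr0 min_l// normr0 mul0r.
  rewrite add0r; apply.
  apply: (@sum_le_mono _ _ _ (fun m => C * C1 *
    (decay r gamma (n - m) * decay r gamma (m - l)))
    (C * C1 * (cc * decay r gamma (n - l)))).
  - move=> m; rewrite mulrACA; apply: ler_pM; rewrite ?mulr_ge0 ?normc_ge0//.
    apply: le_trans (AC n m); rewrite ler_wpM2l ?normc_ge0//.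
    exact: SC.
  - by rewrite !mulrA.
  by apply: sum_leZ; [rewrite mulr_ge0|exact: sum_le_decay_conv2].
(* At m = k the truncation is inactive, and x = S (T x). Applying S costs a second convolution,
   hence the square of [cc]. *)
have -> : `|k 0 j - l 0 j|%:~R * normc (entry S k l) = normc (S (T x) k).
  by rewrite TK xE normcM normc_real (ger0_norm (tau0 k)) /tau /K minxx.
apply: (@normc_op_le _ _ S M) => //.
apply: (@sum_le_mono _ _ _ (fun m => C1 * (C * C1 * cc) *
    (decay r gamma (k - m) * decay r gamma (m - l)))
    (C1 * (C * C1 * cc) * (cc * decay r gamma (k - l)))).
- by move=> n; rewrite mulrACA; apply: ler_pM; rewrite ?mulr_ge0 ?normc_ge0.
- by rewrite expr2 !mulrA.
have cc0 : 0 <= cc.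
  have c0 : 0 <= c by apply: sum_le_ge0 rc => ?; exact: isodecay_ge0.
  by rewrite mulr_ge0 ?powR_ge0 ?addr_ge0.
apply: sum_leZ; last exact: sum_le_decay_conv2.
exact: mulr_ge0 C10 (mulr_ge0 (mulr_ge0 C0 C10) cc0).
Qed.

(** Induction on the sum of the beta_j, for all beta below alpha, starting from [jaffard] at beta =
    0. One unit of beta_j is gained from [derivation_bound] with gamma = beta - e_j: the weight beta
    on A is exactly weight gamma on D_j A up to a constant. *)
Lemma inverse_decay (A : Zd -> Zd -> R[i]) (S T : {linear vec -> vec})
    (r C : R) alpha :
  (1 <= d)%N -> d%:R < r -> 0 < C ->
  (forall k m, normc (A k m) <= C * decay r alpha (k - m)) ->
  induces A T -> bounded_op S -> cancel T S -> cancel S T ->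
  forall beta, (forall j, 0 <= beta 0 j <= alpha 0 j) ->
  exists C', 0 < C' /\
    forall k l, normc (entry S k l) <= C' * decay r beta (k - l).
Proof.
move=> d1 dr C0 AC AT Sb TK SK beta.
have r0 : 0 < r by apply: le_lt_trans dr.
move en : (\sum_j absz (beta 0%R j))%N => n.
elim: n beta en => [|n IHn] beta en beta_le.
  have beta0 : beta = 0.
    apply/rowP => j; rewrite mxE; apply/eqP; rewrite -absz_eq0.
    by move/eqP: en; rewrite sum_nat_eq0 => /forallP/(_ j).
  have [|C' [C'0 SC']] := @jaffard R d A S T r C d1 dr C0 _ AT Sb TK SK.
    move=> k m; apply: le_trans (AC k m) _; rewrite ler_wpM2l ?(ltW C0)//.
    rewrite -decay0; apply: decay_anti => j; rewrite mxE.
    by case/andP: (beta_le j) => H; exact: le_trans.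
  by exists C'; split => // k l; rewrite beta0 decay0.
have [j betaj] : exists j, 0 < beta 0 j.
  apply/not_existsP => H; move: en; rewrite big1// => j _.
  have /negP := H j; rewrite -leNgt => Hj.
  by apply/eqP; rewrite absz_eq0 eq_le Hj; case/andP: (beta_le j).
pose gamma : Zd := beta - delta_mx 0 j.
have gammaE i : gamma 0 i = beta 0 i - (i == j)%:R by rewrite !mxE eqxx.
have gamma_le i : 0 <= gamma 0 i <= beta 0 i.
  rewrite gammaE; case/andP: (beta_le i) => H _.
  by case: eqP => [->|_] /=; lia.
have en' : (\sum_i absz (gamma 0%R i))%N = n.
  apply: succn_inj; rewrite -en (bigD1 j)//= [in RHS](bigD1 j)//=.
  rewrite -addSn; congr addn; first by rewrite gammaE eqxx /=; lia.
  by apply: eq_bigr => i ij; rewrite gammaE (negbTE ij) subr0.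
have [|C1 [C10 SC1]] := IHn gamma en'.
  move=> i; case/andP: (gamma_le i) => -> H /=.
  by case/andP: (beta_le i) => _; exact: le_trans.
have [c rc] := sum_le_isodecay (R := R) d1 dr.
have AD (k m : Zd) : normc (A k m) * `|k 0 j - m 0 j|%:~R <=
    C * decay r gamma (k - m).
  apply: (@le_trans _ _ (C * decay r beta (k - m) * `|k 0 j - m 0 j|%:~R)).
    rewrite ler_wpM2r ?ler0z//; apply: le_trans (AC k m) _.
    rewrite ler_wpM2l ?(ltW C0)//; apply: decay_anti => i.
    by case/andP: (beta_le i).
  rewrite -mulrA ler_wpM2l ?(ltW C0)// /gamma decay_delta mulrC.
  rewrite ler_wpM2r ?(ltW (decay_gt0 _ _ _))// !mxE lerDr.
  exact: ler01.
have gamma0 i : 0 <= gamma 0 i by case/andP: (gamma_le i).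
have DS := derivation_bound (ltW r0) gamma0 rc AT Sb TK SK
  (ltW C0) (ltW C10) AD SC1.
set C2 := C1 * (C * C1) * _ in DS.
have C20 : 0 <= C2.
  by rewrite mulr_ge0 ?sqr_ge0// !mulr_ge0 ?(ltW C0) ?(ltW C10).
(* Adding the bounds on |S k l| and |k_j - l_j| |S k l| produces 1 + |k_j - l_j| on the left, the
   same factor by which the weights gamma and beta differ; it cancels. *)
exists (C1 + C2); split; first by rewrite ltr_wpDr.
move=> k l; have := lerD (SC1 k l) (DS k l).
rewrite -mulrDl -{1}[normc _]mul1r -mulrDl /gamma decay_delta !mxE.
by rewrite mulrCA ler_pM2l ?coord1_gt0.
Qed.

End Anisotropic.

Theorem theorem1p1 (R : realType) (d : nat) (hd : (1 <= d)%N)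
    (A : 'rV[int]_d -> 'rV[int]_d -> R[i])
    (r : R) (hr : d%:R < r)
    (alpha : 'rV[int]_d) (halpha : forall j : 'I_d, 0 <= alpha 0 j)
    (Ainv : {linear ell2 R 'rV[int]_d -> ell2 R 'rV[int]_d})
    (hAinv : is_inverse_on_ell2 A Ainv)
    (hA : exists C : R, 0 < C /\
       forall k l : 'rV[int]_d, normc (A k l) <= C * decay r alpha (k - l)) :
  exists C' : R, 0 < C' /\
    forall k l : 'rV[int]_d,
      normc (entry Ainv k l) <= C' * decay r alpha (k - l).
Proof.
case: hAinv hA => Sb [T [AT _ TK SK]] [C [C0 AC]].
by apply: (inverse_decay hd hr C0 AC AT Sb TK SK) => j; rewrite halpha lexx.
Qed.
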